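(* For every $\varepsilon>0$ there is $d_0=d_0(\varepsilon)$ such that for $d\ge d_0$, $0<\beta\le(1-\varepsilon)\beta_c(d)$, $(G,\mathcal J,\beta)\in\mathcal G(d,\varepsilon)$ with $G=(V,E)$ on $n$ vertices, and any $(d,\varepsilon)$-block partition $\mathcal B$ of $G$, the following holds. Let $\sigma,\tau\in\{\pm1\}^V$ differ exactly at one vertex $u^*$, and suppose $u^*\in\mathrm W$. Let $B\in\mathcal B$ with $u^*\in\partial_{\rm out}B$, and let $z$ be the unique neighbour of $u^*$ in $B$. Then there is a coupling of $X'$ and $Y'$, where $X'$ (resp. $Y'$) equals $\sigma$ (resp. $\tau$) outside $B$ and its restriction to $B$ is drawn from the marginal of $\mu_{G,\mathcal J,\beta}$ on $B$ conditional on $\sigma$ (resp. $\tau$) outside $B$, such that $$\mathbb E\big[\mathrm{dist}(X',Y')\big]-\mathrm{dist}(\sigma,\tau)\le \Gamma_{\{u^*,z\}}\cdot n^4\cdot(1-\varepsilon/6).$$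
   Context: $\mu_{G,\mathcal J,\beta}(\sigma)\propto\exp(\beta\sum_{\{x,y\}\in E}\mathbf 1\{\sigma(x)=\sigma(y)\}J_{\{x,y\}})$; $\beta_c(k)=\sqrt{2\pi}/k$. Influence $\Gamma_e=\frac{|1-\exp(\beta J_e)|}{1+\exp(\beta J_e)}$; $\mathcal A(u)=\sum_{w\sim u}\Gamma_{\{u,w\}}$; $M(u)=1-\varepsilon/4$ if $\mathcal A(u)\le1-\varepsilon/2$, else $d\,\mathcal A(u)$; $M(P)=\prod_{v\in P}M(v)$ for a path (length = number of edges). $(d,\varepsilon)$-block vertex: every path of length at most $\log n$ from it has $M(P)<1$. $\partial_{\rm out}B$: vertices outside $B$ with a neighbour in $B$. $(d,\varepsilon)$-block partition: partition of $V$ into blocks each inducing a tree with at most one extra edge; for $|B|\ge2$, each $w\in\partial_{\rm out}B$ is a $(d,\varepsilon)$-block vertex with exactly one neighbour in $B$, any cycle in $B$ has length at most $4\log n/\log^4d$ and distance at least $\log^5d$ from the boundary of $B$; a single-vertex block is a $(d,\varepsilon)$-block vertex. $\Upsilon(P)=\beta\sum_e|J_e|+\sum_{v\in P}\log\deg(v)$ (first sum over edges with an endpoint in $P$). $\mathcal G(d,\varepsilon)$: triplets with $0<\beta\le(1-\varepsilon)\beta_c(d)$ such that $G$ admits a $(d,\varepsilon)$-block partition, every path of length at most $\log n/\log^4d$ has $\Upsilon(P)\le\log n/\log^2d$, and $n^{-7/3}\le|J_e|\le10\sqrt{\log n}$ for all edges. For $z\in V$ let $B_z$ be its block and $\mathcal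 A_{\rm out}(z)=\sum_{w\sim z,\,w\notin B_z}\Gamma_{\{z,w\}}$; $\mathrm W=\{z:\mathcal A_{\rm out}(z)>0\}$. The distance on $\{\pm1\}^V$ is $\mathrm{dist}(\sigma,\tau)=\sum_{z\in V\setminus\mathrm W}\mathbf 1\{\sigma(z)\ne\tau(z)\}+n^4\sum_{z\in\mathrm W}\mathcal A_{\rm out}(z)\mathbf 1\{\sigma(z)\ne\tau(z)\}$. *)

(* Defs.v *)
From HB Require Import structures.
From mathcomp Require Import all_boot all_order all_algebra.
From mathcomp Require Import boolp classical_sets reals ereal sequences exp trigo.
From mathcomp Require Import finset.

Set Implicit Arguments.
Unset Strict Implicit.
Unset Printing Implicit Defensive.
Import Order.TTheory GRing.Theory Num.Theory.
Local Open Scope ring_scope.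

Record sgraph (V : finType) := SGraph {
  edges : {set {set V}};
  edges_card2 : forall f : {set V}, f \in edges -> #|f| = 2%N
}.

(* [joined F x x] is false for every F made of 2-element sets. *)
Definition joined (V : finType) (F : {set {set V}}) : rel V :=
  fun x y => [set x; y] \in F.

Definition adj (V : finType) (G : sgraph V) : rel V := joined (edges G).

Definition deg (V : finType) (G : sgraph V) (v : V) : nat :=
  #|[set w | adj G v w]|.

(* Paths are self-avoiding; [x :: p] lists the vertices, so the length is
   [size p], and the path of length 0 is allowed. *)
Definition gpath (V : finType) (G : sgraph V) (x : V) (p : seq V) : bool :=
  path (adj G) x p && uniq (x :: p).

Definition gcycle (V : finType) (F : {set {set V}}) (c : seq V) : bool :=
  (2 < size c)%N && ucycleb (joined F) c.

Definition induced_edges (V : finType) (G : sgraph V) (B : {set V}) :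
  {set {set V}} := [set f in edges G | f \subset B].

Definition is_tree (V : finType) (B : {set V}) (T : {set {set V}}) : Prop :=
  (forall x y, x \in B -> y \in B -> connect (joined T) x y) /\
  (forall c, ~~ gcycle T c).

Definition tree_plus_edge (V : finType) (G : sgraph V) (B : {set V}) : Prop :=
  exists T : {set {set V}},
    [/\ T \subset induced_edges G B, is_tree B T
      & (#|induced_edges G B :\: T| <= 1)%N].

Definition bd_out (V : finType) (G : sgraph V) (B : {set V}) : {set V} :=
  [set w | (w \notin B) && [exists x in B, adj G w x]].

(* +oo when no walk joins A to B, in particular when one of them is empty. *)
Definition set_dist (R : realType) (V : finType) (G : sgraph V)
    (A B : {set V}) : \bar R :=
  ereal_inf [set l : \bar R | exists x p,
    [/\ x \in A, path (adj G) x p, last x p \in B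
      & l = ((size p)%:R)%:E]]%classic.

Definition beta_c (R : realType) (k : R) : R := Num.sqrt (2 * pi) / k.

(* The couplings J are indexed by 2-element sets of vertices; their values
   outside [edges G] are never used. *)
Definition Gamma (R : realType) (V : finType) (J : {set V} -> R) (beta : R)
    (f : {set V}) : R :=
  `|1 - expR (beta * J f)| / (1 + expR (beta * J f)).

Definition aggregate (R : realType) (V : finType) (G : sgraph V)
    (J : {set V} -> R) (beta : R) (u : V) : R :=
  \sum_(w | adj G u w) Gamma J beta [set u; w].

Definition Mweight (R : realType) (V : finType) (G : sgraph V)
    (J : {set V} -> R) (beta d eps : R) (u : V) : R :=
  if aggregate G J beta u <= 1 - eps / 2 then 1 - eps / 4
  else d * aggregate G J beta u.

Definition block_vertex (R : realType) (V : finType) (G : sgraph V)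
    (J : {set V} -> R) (beta d eps : R) (u : V) : Prop :=
  forall p : seq V, gpath G u p -> (size p)%:R <= ln (#|V|%:R : R) ->
    \prod_(v <- u :: p) Mweight G J beta d eps v < 1.

Definition block_partition (R : realType) (V : finType) (G : sgraph V)
    (J : {set V} -> R) (beta d eps : R) (BB : {set {set V}}) : Prop :=
  finset.partition BB [set: V] /\
  forall B : {set V}, B \in BB ->
    [/\ tree_plus_edge G B,
        (2 <= #|B|)%N ->
          (forall w, w \in bd_out G B ->
             block_vertex G J beta d eps w /\
             #|[set x in B | adj G w x]| = 1%N) /\
          (forall c : seq V, gcycle (edges G) c -> {subset c <= B} ->
             (size c)%:R <= 4 * ln (#|V|%:R : R) / ln d ^+ 4 /\
             (((ln d ^+ 5)%:E : \bar R)
                <= set_dist R G [set x in c] (bd_out G B))%E)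
      & forall v, B = [set v] -> block_vertex G J beta d eps v].

Definition Upsilon (R : realType) (V : finType) (G : sgraph V)
    (J : {set V} -> R) (beta : R) (P : seq V) : R :=
  beta * (\sum_(f in edges G | [exists v in f, v \in P]) `|J f|)
  + \sum_(v <- P) ln ((deg G v)%:R : R).

Definition calG (R : realType) (V : finType) (d eps : R) (G : sgraph V)
    (J : {set V} -> R) (beta : R) : Prop :=
  [/\ 0 < beta <= (1 - eps) * beta_c d,
      exists BB : {set {set V}}, block_partition G J beta d eps BB,
      forall x p, gpath G x p -> (size p)%:R <= ln (#|V|%:R : R) / ln d ^+ 4 ->
        Upsilon G J beta (x :: p) <= ln (#|V|%:R : R) / ln d ^+ 2
    & forall f, f \in edges G ->
        (#|V|%:R : R) `^ (- (7 / 3)) <= `|J f|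
          <= 10 * Num.sqrt (ln (#|V|%:R : R))].

(* Spins: [true] is +1 and [false] is -1; only their equality matters. *)
Definition config (V : finType) : finType := {ffun V -> bool}.

Definition monochromatic (V : finType) (s : config V) (f : {set V}) : bool :=
  [forall x in f, forall y in f, s x == s y].

Definition gibbs_weight (R : realType) (V : finType) (G : sgraph V)
    (J : {set V} -> R) (beta : R) (s : config V) : R :=
  expR (beta * \sum_(f in edges G) (monochromatic s f)%:R * J f).

Definition gibbs (R : realType) (V : finType) (G : sgraph V)
    (J : {set V} -> R) (beta : R) (s : config V) : R :=
  gibbs_weight G J beta s / \sum_(t : config V) gibbs_weight G J beta t.

Definition agree_outside (V : finType) (B : {set V}) (s t : config V) : bool :=
  [forall v in ~: B, s v == t v].

(* The law of the configuration equal to s outside B whose restriction to B is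
   drawn from the Gibbs measure conditional on s outside B. *)
Definition block_update (R : realType) (V : finType) (G : sgraph V)
    (J : {set V} -> R) (beta : R) (B : {set V}) (s t : config V) : R :=
  if agree_outside B s t then
    gibbs G J beta t / \sum_(t' | agree_outside B s t') gibbs G J beta t'
  else 0.

Definition Aout (R : realType) (V : finType) (G : sgraph V)
    (J : {set V} -> R) (beta : R) (BB : {set {set V}}) (z : V) : R :=
  \sum_(w | adj G z w && (w \notin finset.pblock BB z)) Gamma J beta [set z; w].

Definition Wset (R : realType) (V : finType) (G : sgraph V)
    (J : {set V} -> R) (beta : R) (BB : {set {set V}}) : {set V} :=
  [set z | 0 < Aout G J beta BB z].

Definition config_dist (R : realType) (V : finType) (G : sgraph V)
    (J : {set V} -> R) (beta : R) (BB : {set {set V}}) (s t : config V) : R :=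
  \sum_(z in ~: Wset G J beta BB) (s z != t z)%:R
  + #|V|%:R ^+ 4 *
    \sum_(z in Wset G J beta BB) Aout G J beta BB z * (s z != t z)%:R.

Definition is_coupling (R : realType) (S : finType) (p q : S -> R)
    (Q : S -> S -> R) : Prop :=
  [/\ forall x y, 0 <= Q x y,
      forall x, \sum_y Q x y = p x
    & forall y, \sum_x Q x y = q y].

(* Main.v *)
Require Import Defs.
From HB Require Import structures.
From mathcomp Require Import all_boot all_order all_algebra.
From mathcomp Require Import boolp classical_sets reals ereal sequences exp trigo.
From mathcomp Require Import finset.
From mathcomp Require Import ring lra zify.
Set Implicit Arguments.
Unset Strict Implicit.
Unset Printing Implicit Defensive.
Import Order.TTheory GRing.Theory Num.Theory.
Local Open Scope ring_scope.

(** On any graph, flipping one spin [u] outside a set [S] can be coupled so that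
    the expected weighted number of disagreements in [S] is at most the sum over
    self-avoiding walks from [u] into [S] of the product of the influences times
    the weight of the endpoint.  The flip of [u] is a change of external fields
    at its neighbours; the fields are changed one at a time and the couplings are
    glued.  A change of field at [z] alters the marginal at [z] by at most the
    influence of the edge, and a disagreement at [z] is a flip outside [S :\ z],
    so induction on [#|S|] applies.

    For a block [B], let [L] be the integer part of [log n].  A walk ending at a
    vertex with [Aout > 0] is seen from both of its ends by a block vertex:
    [ustar] and an outer neighbour of the endpoint.  If the walk has fewer than
    [2 L] edges, the two block conditions bound the product of the aggregate
    influences along it by [1 - eps / 2], and the sum over such walks is at most
    the largest such product.  On a longer walk, AM-GM gains a factor [1/2] at
    each of about [2 L] vertices near the ends, so its weight is at most
    [8 / 4 ^+ L]; since a tree with an extra edge has at most three self-avoiding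
    walks between two vertices and each outer boundary vertex has one neighbour
    in [B], these walks contribute at most [24 n / 4 ^+ L], which is small because
    [4 > e].  Vertices outside [W] contribute at most [3 n], negligible against
    [n ^+ 4].  That [n] is large in terms of [eps] follows from the bound on
    [Upsilon] at the single vertex [z], whose degree is at least two. *)

(** * Couplings of laws on a finite set and their expected cost *)

Section Couplings.
Variables (R : realType) (S : finType).
Implicit Types (p q r : S -> R) (Q : S -> S -> R) (D : S -> S -> R).

Definition cost Q D : R := \sum_x \sum_y Q x y * D x y.

Lemma coupling_map p q (f : S -> S) D :
  (forall x, 0 <= p x) -> (forall y, q y = \sum_(x | f x == y) p x) ->
  exists Q, is_coupling p q Q /\ cost Q D = \sum_x p x * D x (f x).
Proof.
move=> p0 pq; exists (fun x y => p x * (f x == y)%:R); split; first split.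
- by move=> x y; rewrite mulr_ge0 ?ler0n.
- move=> x; rewrite -mulr_sumr (bigD1 (f x)) //= eqxx big1 ?addr0 ?mulr1 //.
  by move=> y /negPf; rewrite eq_sym => ->.
- move=> y; rewrite pq [RHS]big_mkcond; apply: eq_bigr => x _.
  by case: eqP => _; rewrite ?mulr1 ?mulr0.
apply: eq_bigr => x _; rewrite (bigD1 (f x)) //= eqxx mulr1 big1 ?addr0 //.
by move=> y /negPf; rewrite eq_sym => ->; rewrite mulr0 mul0r.
Qed.

Lemma coupling_eq p q D : (forall x, 0 <= p x) -> p =1 q ->
  (forall x, D x x = 0) -> exists Q, is_coupling p q Q /\ cost Q D = 0.
Proof.
move=> p0 pq D0.
have [|Q [cQ eQ]] := @coupling_map p q id D p0.
  by move=> y; rewrite -pq big_pred1_eq.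
by exists Q; split=> //; rewrite eQ big1 // => x _; rewrite D0 mulr0.
Qed.

(** Gluing: given the middle configuration, the two outer ones are taken conditionally independent.
    Dividing by [q y = 0] is harmless, since then [Q1 x y] and [Q2 y z] vanish too. *)
Lemma coupling_trans p q r Q1 Q2 D :
  (forall x y z, D x z <= D x y + D y z) ->
  is_coupling p q Q1 -> is_coupling q r Q2 ->
  exists Q, is_coupling p r Q /\ cost Q D <= cost Q1 D + cost Q2 D.
Proof.
move=> Dtri [Q1_ge0 Q1p Q1q] [Q2_ge0 Q2q Q2r].
have q_ge0 y : 0 <= q y by rewrite -Q1q sumr_ge0.
have Q1_0 x y : q y = 0 -> Q1 x y = 0.
  rewrite -Q1q => /eqP; rewrite psumr_eq0 // => /allP /(_ x).
  by rewrite mem_index_enum => /(_ isT) /eqP.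
have Q2_0 y z : q y = 0 -> Q2 y z = 0.
  rewrite -Q2q => /eqP; rewrite psumr_eq0 // => /allP /(_ z).
  by rewrite mem_index_enum => /(_ isT) /eqP.
have sum1 x y : \sum_z Q1 x y * Q2 y z / q y = Q1 x y.
  rewrite -mulr_suml -mulr_sumr Q2q; have [q0|q0] := eqVneq (q y) 0.
    by rewrite Q1_0 // !mul0r.
  by rewrite mulfK.
have sum2 y z : \sum_x Q1 x y * Q2 y z / q y = Q2 y z.
  rewrite -mulr_suml -mulr_suml Q1q; have [q0|q0] := eqVneq (q y) 0.
    by rewrite Q2_0 // mulr0 mul0r.
  by rewrite mulrAC mulfV // mul1r.
exists (fun x z => \sum_y Q1 x y * Q2 y z / q y); split; first split.
- by move=> x z; apply: sumr_ge0 => y _; rewrite divr_ge0 ?mulr_ge0.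
- by move=> x; rewrite exchange_big -Q1p; apply: eq_bigr.
- by move=> z; rewrite exchange_big -Q2r; apply: eq_bigr.
have -> : cost Q1 D + cost Q2 D =
    \sum_x \sum_z \sum_y (Q1 x y * Q2 y z / q y) * (D x y + D y z).
  transitivity (\sum_x \sum_z \sum_y (Q1 x y * Q2 y z / q y) * D x y
     + \sum_x \sum_z \sum_y (Q1 x y * Q2 y z / q y) * D y z); last first.
    rewrite -big_split; apply: eq_bigr => x _; rewrite -big_split.
    apply: eq_bigr => z _; rewrite -big_split; apply: eq_bigr => y _ /=.
    by rewrite mulrDr.
  congr (_ + _).
    apply: eq_bigr => x _; rewrite exchange_big; apply: eq_bigr => y _ /=.
    by rewrite -mulr_suml sum1.
  rewrite exchange_big /= /cost exchange_big /=; apply: eq_bigr => z _.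
  rewrite exchange_big; apply: eq_bigr => y _ /=.
  by rewrite -mulr_suml sum2.
apply: ler_sum => x _; apply: ler_sum => z _; rewrite mulr_suml.
by apply: ler_sum => y _; rewrite ler_wpM2l // divr_ge0 ?mulr_ge0.
Qed.

(** The indices are coupled first, by [P]; the components are then coupled given the pair of
    indices. *)
Lemma coupling_mixture (I : finType) (a b : I -> R) (p q : I -> S -> R)
    (P : I -> I -> R) (Q : I -> I -> S -> S -> R) D :
  is_coupling a b P -> (forall i j, is_coupling (p i) (q j) (Q i j)) ->
  exists Q', is_coupling (fun x => \sum_i a i * p i x)
                         (fun x => \sum_i b i * q i x) Q' /\
    cost Q' D = \sum_i \sum_j P i j * cost (Q i j) D.
Proof.
move=> [P0 Pa Pb] cQ.
exists (fun x y => \sum_i \sum_j P i j * Q i j x y); split; first split.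
- move=> x y; apply: sumr_ge0 => i _; apply: sumr_ge0 => j _.
  by rewrite mulr_ge0 //; case: (cQ i j).
- move=> x; rewrite exchange_big; apply: eq_bigr => i _ /=.
  rewrite exchange_big -Pa mulr_suml; apply: eq_bigr => j _ /=.
  by rewrite -mulr_sumr; case: (cQ i j) => _ -> _.
- move=> y; rewrite exchange_big /=.
  transitivity (\sum_i \sum_j P i j * q j y); last first.
    rewrite exchange_big; apply: eq_bigr => j _ /=.
    by rewrite -mulr_suml Pb.
  apply: eq_bigr => i _ /=; rewrite exchange_big; apply: eq_bigr => j _ /=.
  by rewrite -mulr_sumr; case: (cQ i j) => _ _ ->.
rewrite /cost.
transitivity (\sum_x \sum_y \sum_i \sum_j P i j * (Q i j x y * D x y)).
  apply: eq_bigr => x _; apply: eq_bigr => y _; rewrite mulr_suml.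
  apply: eq_bigr => i _; rewrite mulr_suml; apply: eq_bigr => j _.
  by rewrite mulrA.
under eq_bigr do rewrite exchange_big.
rewrite exchange_big; apply: eq_bigr => i _ /=.
under eq_bigr do rewrite exchange_big.
rewrite exchange_big; apply: eq_bigr => j _ /=.
by rewrite mulr_sumr; apply: eq_bigr => x _; rewrite mulr_sumr.
Qed.

Lemma coupling_bool (a b : bool -> R) :
  (forall c, 0 <= a c) -> (forall c, 0 <= b c) ->
  a true + a false = 1 -> b true + b false = 1 ->
  exists P : bool -> bool -> R, is_coupling a b P /\
    P true false + P false true = `|a true - b true|.
Proof.
move=> a0 b0 a1 b1.
(* The optimal coupling: with two values, the excess of [a] over [b] at [c] can only go to the other
   value. *)
exists (fun c c' => if c == c' then Num.min (a c) (b c)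
                    else a c - Num.min (a c) (b c)).
have := a0 true; have := a0 false; have := b0 true; have := b0 false => *.
have [ab|ab] := leP (a true) (b true).
  have abt : Num.min (a true) (b true) = a true by apply: min_l.
  have abf : Num.min (a false) (b false) = b false by apply: min_r; lra.
  split; first split.
  - by case=> -[] /=; rewrite ?(abt, abf); lra.
  - by case=> /=; rewrite big_bool /=; rewrite ?(abt, abf); lra.
  - by case=> /=; rewrite big_bool /=; rewrite ?(abt, abf); lra.
  by rewrite /= ler0_norm; rewrite ?(abt, abf); lra.
have abt : Num.min (a true) (b true) = b true by apply: min_r; lra.
have abf : Num.min (a false) (b false) = a false by apply: min_l; lra.
split; first split.
- by case=> -[] /=; rewrite ?(abt, abf); lra.
- by case=> /=; rewrite big_bool /=; rewrite ?(abt, abf); lra.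
- by case=> /=; rewrite big_bool /=; rewrite ?(abt, abf); lra.
by rewrite /= ger0_norm; rewrite ?(abt, abf); lra.
Qed.

End Couplings.

(** * Adjacency and the edges at a vertex *)

Section Graph.
Variables (V : finType) (G : sgraph V).

Lemma adjC (x y : V) : adj G x y = adj G y x.
Proof. by rewrite /adj /joined finset.setUC. Qed.

Lemma adj_neq (x y : V) : adj G x y -> x != y.
Proof. by move=> /edges_card2; rewrite cards2; case: (x != y). Qed.

Lemma sum_edges_at (R : nmodType) (u : V) (phi : {set V} -> R) :
  \sum_(f in edges G | u \in f) phi f = \sum_(v | adj G u v) phi [set u; v].
Proof.
transitivity (\sum_(v in [set v | adj G u v]) phi [set u; v]); last first.
  by apply: eq_bigl => v; rewrite inE.
rewrite -(big_imset (h := fun v => [set u; v])) /=; last first.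
  move=> v w; rewrite !inE => uv uw /setP /(_ v).
  rewrite !inE eqxx orbT; have := adj_neq uv; rewrite eq_sym => /negPf -> /=.
  by move=> /esym /eqP.
apply: eq_bigl => f; apply/andP/imsetP => [[fE uf]|[v]]; last first.
  by rewrite inE => uv ->; rewrite !inE eqxx.
have /cards2P[x [y [xy ff]]] : #|f| == 2 by rewrite (edges_card2 fE).
move: uf fE; rewrite ff !inE => /orP[/eqP-> ?|/eqP->]; first by exists y; rewrite ?inE.
by rewrite finset.setUC => ?; exists x; rewrite ?inE.
Qed.

End Graph.

(** * Spin configurations and pinning the spin of a vertex *)

Section Configurations.
Variable V : finType.
Implicit Types (s x y : config V) (S : {set V}).

Definition upd s (z : V) (c : bool) : config V :=
  [ffun v => if v == z then c else s v].

Lemma agree_outsideP S s x :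
  reflect (forall v, v \notin S -> s v = x v) (agree_outside S s x).
Proof.
apply: (iffP forallP) => [H v vS|H v].
  by have := H v; rewrite inE vS => /eqP.
by apply/implyP; rewrite inE => /H ->.
Qed.

Lemma agree_outside_upd S s z c x : z \in S ->
  agree_outside (S :\ z) (upd s z c) x = agree_outside S s x && (x z == c).
Proof.
move=> zS; apply/agree_outsideP/andP => [H|[/agree_outsideP H /eqP xz] v].
  split; last by have := H z; rewrite !inE eqxx ffunE eqxx /= => ->.
  apply/agree_outsideP => v vS; have := H v; rewrite !inE (negPf vS) andbF.
  rewrite ffunE; case: eqP => [vz|_]; last exact.
  by move: vS; rewrite vz zS.
rewrite !inE ffunE; case: eqP => [->|_]; first by rewrite xz.
exact: H.
Qed.

Lemma monochromatic2 s (u v : V) : monochromatic s [set u; v] = (s u == s v).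
Proof.
apply/forall_inP/eqP => [H|e x xf].
  have /forall_inP/(_ v) := H u (set21 u v).
  by rewrite set22 => /(_ isT) /eqP.
apply/forall_inP => y; move: xf; rewrite !inE.
by move=> /orP[]/eqP -> /orP[]/eqP ->; rewrite ?e.
Qed.

End Configurations.

(** * Self-avoiding walks and their influence weights *)

Section SelfAvoidingWalks.
Variables (R : realType) (V : finType) (G : sgraph V) (J : {set V} -> R).
Variable beta : R.

(** A walk is the list of the vertices after its start [v]. Deleting [v] from [S] at each step
    forces self-avoidance, and [k] is fuel: with [#|S| <= k] no walk is cut off. *)
Fixpoint saws (k : nat) (S : {set V}) (v : V) : seq (seq V) :=
  [::] :: if k is k'.+1 then
    flatten [seq map (cons c) (saws k' (S :\ v) c)
            | c <- enum [set c in S :\ v | adj G v c]]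
  else [::].

Fixpoint walk_weight (v : V) (q : seq V) : R :=
  if q is c :: q' then Gamma J beta [set v; c] * walk_weight c q' else 1.

Definition saw_sum (w : V -> R) (k : nat) (S : {set V}) (v : V) : R :=
  \sum_(q <- saws k S v) walk_weight v q * w (last v q).

Lemma big_sawsS (phi : seq V -> R) (P : pred (seq V)) k S v :
  \sum_(q <- saws k.+1 S v | P q) phi q =
  (if P [::] then phi [::] else 0) +
  \sum_(c in S :\ v | adj G v c)
     \sum_(q <- saws k (S :\ v) c | P (c :: q)) phi (c :: q).
Proof.
rewrite /= big_mkcond big_cons -big_mkcond; congr (_ + _).
rewrite big_flatten big_map big_enum_cond /=.
rewrite [LHS](eq_bigl (fun c => (c \in S :\ v) && adj G v c)); last first.
  by move=> c; rewrite !inE andbT.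
by apply: eq_bigr => c _; rewrite big_map.
Qed.

Lemma saw_sumS w k S v : saw_sum w k.+1 S v =
  w v + \sum_(c in S :\ v | adj G v c)
          Gamma J beta [set v; c] * saw_sum w k (S :\ v) c.
Proof.
rewrite /saw_sum big_sawsS /= mul1r; congr (_ + _).
apply: eq_bigr => c _; rewrite mulr_sumr; apply: eq_bigr => q _.
by rewrite mulrA.
Qed.

Lemma saw_mem k S v q : q \in saws k S v ->
  [/\ path (adj G) v q, uniq (v :: q) & {subset q <= S}].
Proof.
elim: k S v q => [|k IH] S v q.
  by rewrite inE => /eqP ->.
rewrite inE => /orP[/eqP -> //|/flatten_mapP[c]].
rewrite mem_enum !inE => /andP[/andP[cv cS] vc] /mapP[q' /IH[pq uq sq] ->].
split.
- by rewrite /= vc.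
- rewrite cons_uniq uq andbT inE eq_sym (negPf cv) /=.
  by apply/negP => /sq; rewrite !inE eqxx.
move=> x; rewrite inE => /orP[/eqP -> //|/sq].
by rewrite !inE => /andP[].
Qed.

Lemma saws_uniq k S v : uniq (saws k S v).
Proof.
elim: k S v => [|k IH] S v //=.
apply/andP; split.
  by apply/negP => /flatten_mapP[c _ /mapP[]].
move: (enum_uniq [set c in S :\ v | adj G v c]).
elim: (enum _) => //= c r IHr /andP[cr ur].
rewrite cat_uniq IHr // andbT map_inj_uniq ?IH; last by move=> x y [].
apply/hasPn => q /flatten_mapP[c' c'r /mapP[q' _ ->]].
by apply/negP => /mapP[q2 _ [cc' _]]; move: cr; rewrite -cc' c'r.
Qed.

Lemma Gamma_ge0 f : 0 <= Gamma J beta f.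
Proof. by rewrite divr_ge0 ?addr_ge0 ?expR_ge0. Qed.

Lemma Gamma_le1 f : Gamma J beta f <= 1.
Proof.
rewrite ler_pdivrMr ?mul1r; last by rewrite ltr_pwDl ?expR_ge0.
by have := expR_ge0 (beta * J f); case: (ger0P (1 - expR (beta * J f))); lra.
Qed.

Lemma walk_weight_ge0 v q : 0 <= walk_weight v q.
Proof. by elim: q v => //= c q IH v; rewrite mulr_ge0 ?Gamma_ge0. Qed.

Lemma walk_weight_le1 v q : walk_weight v q <= 1.
Proof.
by elim: q v => //= c q IH v; rewrite mulr_ile1 ?Gamma_ge0 ?Gamma_le1 ?walk_weight_ge0.
Qed.

End SelfAvoidingWalks.

(** * Gibbs laws with external fields and a frozen exterior *)

Section GibbsWithFields.
Variables (R : realType) (V : finType) (G : sgraph V) (J : {set V} -> R).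
Variable beta : R.
Implicit Types (s x y : config V) (S : {set V}) (h : V -> bool -> R).

(** The field [h v c] is an arbitrary log-weight of the spin [c] at [v]. Zero fields give the Gibbs
    weight; general ones arise because a flip outside [S] acts inside as a change of fields. *)
Definition fweight h x : R :=
  expR (beta * \sum_(f in edges G) (monochromatic x f)%:R * J f
        + \sum_v h v (x v)).

Definition fpart h S s : R := \sum_(t | agree_outside S s t) fweight h t.

Definition flaw h S s x : R :=
  if agree_outside S s x then fweight h x / fpart h S s else 0.

Lemma fpart_gt0 h S s : 0 < fpart h S s.
Proof.
rewrite /fpart (bigD1 s) /=; last by apply/agree_outsideP.
by rewrite ltr_pwDl ?expR_gt0 // sumr_ge0 // => t _; apply: expR_ge0.
Qed.

Lemma flaw_ge0 h S s x : 0 <= flaw h S s x.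
Proof.
by rewrite /flaw; case: ifP => // _; rewrite divr_ge0 ?expR_ge0 // ltW ?fpart_gt0.
Qed.

Lemma sum_flaw h S s : \sum_x flaw h S s x = 1.
Proof.
rewrite -big_mkcond -mulr_suml divff //; apply: lt0r_neq0; exact: fpart_gt0.
Qed.

Lemma block_update_flaw S s :
  block_update G J beta S s =1 flaw (fun _ _ => 0) S s.
Proof.
have gwE x : gibbs_weight G J beta x = fweight (fun _ _ => 0) x.
  by rewrite /fweight [X in _ + X]big1 // addr0.
move=> x; rewrite /block_update /flaw; case: ifP => // _.
have -> : \sum_(t | agree_outside S s t) gibbs G J beta t =
    fpart (fun _ _ => 0) S s / \sum_t gibbs_weight G J beta t.
  by rewrite /fpart mulr_suml; apply: eq_bigr => t _; rewrite /gibbs gwE.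
rewrite /gibbs gwE; set Z := \sum_t _; have Z0 : Z != 0.
  apply: lt0r_neq0; rewrite /Z (bigD1 x) //=.
  by rewrite ltr_pwDl ?expR_gt0 // sumr_ge0 // => t _; apply: expR_ge0.
have /lt0r_neq0 P0 := fpart_gt0 (fun _ _ => 0) S s.
by field; rewrite Z0 P0.
Qed.

Lemma fpart_upd h S s z : z \in S ->
  fpart h S s = fpart h (S :\ z) (upd s z true) + fpart h (S :\ z) (upd s z false).
Proof.
move=> zS; rewrite /fpart (bigID (fun t : config V => t z)) /=.
by congr (_ + _); apply: eq_bigl => t; rewrite agree_outside_upd //; case: (t z).
Qed.

Lemma flaw_split h S s z : z \in S ->
  flaw h S s =1 fun x => \sum_c fpart h (S :\ z) (upd s z c) / fpart h S s
                       * flaw h (S :\ z) (upd s z c) x.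
Proof.
move=> zS x; rewrite big_bool /flaw !agree_outside_upd //.
case: (agree_outside S s x) => /=; last by rewrite !mulr0 addr0.
have := fpart_gt0 h S s => /lt0r_neq0 n0.
have := fpart_gt0 h (S :\ z) (upd s z true) => /lt0r_neq0 n1.
have := fpart_gt0 h (S :\ z) (upd s z false) => /lt0r_neq0 n2.
by case: (x z) => /=; field; rewrite ?n0 ?n1 ?n2.
Qed.

Lemma fpart_scale h h' S s (C : R) :
  (forall x, agree_outside S s x -> fweight h' x = C * fweight h x) ->
  fpart h' S s = C * fpart h S s.
Proof. by move=> H; rewrite /fpart mulr_sumr; apply: eq_bigr. Qed.

Lemma flaw_scale h h' S s (C : R) : C != 0 ->
  (forall x, agree_outside S s x -> fweight h' x = C * fweight h x) ->
  flaw h' S s =1 flaw h S s.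
Proof.
move=> C0 H x; rewrite /flaw (fpart_scale H); case: ifP => // xS.
have /lt0r_neq0 n0 := fpart_gt0 h S s.
by rewrite H //; field; rewrite C0 n0.
Qed.

Lemma fweight_field h h' x z : (forall v, v != z -> h' v = h v) ->
  fweight h' x = expR (h' z (x z) - h z (x z)) * fweight h x.
Proof.
move=> hh; rewrite /fweight -expRD; congr expR.
rewrite [X in _ + X = _](bigD1 z) //= [in RHS](bigD1 z) //=.
rewrite [X in _ + (_ + X) = _](eq_bigr (fun v => h v (x v))); first ring.
by move=> v /hh ->.
Qed.

(* Flipping the spin at [u] acts on the rest of the graph as the external field
   [flip_field]. *)
Definition flip_field s (u v : V) (c : bool) : R :=
  beta * J [set u; v] * ((~~ s u == c)%:R - (s u == c)%:R).

Lemma fweight_flip h S s u : u \notin S ->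
  exists2 C : R, C != 0 & forall x, agree_outside S s x ->
    fweight h (upd x u (~~ s u)) =
    C * fweight (fun v c => h v c + ((v \in S) && adj G u v)%:R
                            * flip_field s u v c) x.
Proof.
move=> uS.
(* The constant gathers the edges from [u] to frozen vertices, where [x] agrees with [s], and the
   change of the field term at [u] itself. *)
exists (expR (\sum_(v | adj G u v && (v \notin S)) flip_field s u v (s v)
              + (h u (~~ s u) - h u (s u)))).
  by rewrite lt0r_neq0 ?expR_gt0.
move=> x /agree_outsideP xs; rewrite /fweight -expRD; congr expR.
rewrite [X in _ = _ + (_ + X)]big_split /=.
set y := upd x u (~~ s u).
have yv v : v != u -> y v = x v by move=> vu; rewrite ffunE (negPf vu).
have yu : y u = ~~ s u by rewrite ffunE eqxx.
have xu : x u = s u by rewrite -xs.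
have -> : \sum_v h v (y v) = h u (~~ s u) - h u (s u) + \sum_v h v (x v).
  rewrite (bigD1 u) //= [in RHS](bigD1 u) //= yu xu.
  rewrite [X in _ + X = _](eq_bigr (fun v => h v (x v))); first ring.
  by move=> v /yv ->.
have -> : \sum_(f in edges G) (monochromatic y f)%:R * J f =
    \sum_(f in edges G) (monochromatic x f)%:R * J f +
    \sum_(v | adj G u v) J [set u; v] * ((~~ s u == x v)%:R - (s u == x v)%:R).
  transitivity (\sum_(f in edges G) (monochromatic x f)%:R * J f +
    \sum_(f in edges G | u \in f)
      ((monochromatic y f)%:R - (monochromatic x f)%:R) * J f).
    rewrite [X in _ + X]big_mkcondr -big_split /=; apply: eq_bigr => f fE.
    case: ifP => uf; first by ring.
    rewrite addr0; congr (_%:R * _); congr nat_of_bool.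
    apply/forall_inP/forall_inP => H a af; apply/forall_inP => b bf;
      have /forall_inP/(_ b bf) := H a af; rewrite !yv //;
      by [apply: contraFN uf => /eqP <-].
  congr (_ + _); rewrite sum_edges_at; apply: eq_bigr => v uv.
  rewrite !monochromatic2 yu xu yv; first by rewrite mulrC.
  by rewrite eq_sym; apply: adj_neq uv.
have -> : \sum_v ((v \in S) && adj G u v)%:R * flip_field s u v (x v) =
    \sum_(v | adj G u v && (v \in S)) flip_field s u v (x v).
  rewrite [RHS]big_mkcond; apply: eq_bigr => v _; rewrite andbC.
  by case: ifP; rewrite ?mul1r ?mul0r.
have -> : \sum_(v | adj G u v && (v \notin S)) flip_field s u v (s v) =
    \sum_(v | adj G u v && (v \notin S)) flip_field s u v (x v).
  by apply: eq_bigr => v /andP[_ vS]; rewrite xs.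
have -> : beta * (\sum_(f in edges G) (monochromatic x f)%:R * J f +
    \sum_(v | adj G u v) J [set u; v] * ((~~ s u == x v)%:R - (s u == x v)%:R))
  = beta * (\sum_(f in edges G) (monochromatic x f)%:R * J f) +
    (\sum_(v | adj G u v && (v \in S)) flip_field s u v (x v) +
     \sum_(v | adj G u v && (v \notin S)) flip_field s u v (x v)); last by ring.
rewrite mulrDr -bigID [X in _ + X]mulr_sumr; congr (_ + _).
by apply: eq_bigr => v _; rewrite /flip_field; ring.
Qed.

End GibbsWithFields.

(** * Propagation of a disagreement along self-avoiding walks *)

Section Disagreement.
Variables (R : realType) (V : finType) (G : sgraph V) (J : {set V} -> R).
Variables (beta : R) (w : V -> R).
Hypothesis w_ge0 : forall v, 0 <= w v.
Implicit Types (s x y : config V) (S : {set V}) (h : V -> bool -> R).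

Local Notation Gam := (Gamma J beta).
Local Notation law := (flaw G J beta).
Local Notation part := (fpart G J beta).

Definition wdist S x y : R := \sum_(v in S) w v * (x v != y v)%:R.

Lemma wdist_tri S x y t : wdist S x t <= wdist S x y + wdist S y t.
Proof.
rewrite -big_split; apply: ler_sum => v _ /=; rewrite -mulrDr ler_wpM2l //.
by rewrite -natrD ler_nat; case: (x v) (y v) (t v) => [] [] [].
Qed.

Lemma wdistxx S x : wdist S x x = 0.
Proof. by rewrite /wdist big1 // => v _; rewrite eqxx mulr0. Qed.

(** This is the absolute value of [tanh (t / 2)]; at [beta * J f] it equals [Gamma J beta f]. *)
Definition tanh_gap (t : R) : R := `|1 - expR t| / (1 + expR t).

Lemma tanh_gapN t : tanh_gap (- t) = tanh_gap t.
Proof.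
rewrite /tanh_gap expRN; have t0 := expR_gt0 t.
have -> : 1 - (expR t)^-1 = - ((1 - expR t) / expR t).
  by field; rewrite lt0r_neq0.
rewrite normrN normrM normfV (ger0_norm (ltW t0)).
field; rewrite !lt0r_neq0 // ?addr_gt0 //.
Qed.

(** A change of field multiplies the odds [a / c] by [r ^+ 2]. The difference of probabilities
    factors through [(1 - r) / (1 + r)], and the remaining factor is at most 1 because [(a + c) * (r
    ^+ 2 * a + c) - a * c * (1 + r) ^+ 2] is the square of [r * a - c]. *)
Lemma odds_gap (a c e1 e2 r : R) : 0 < a -> 0 < c -> 0 < e2 -> 0 < r ->
  e1 = r ^+ 2 * e2 ->
  `|a / (a + c) - e1 * a / (e1 * a + e2 * c)| <= `|1 - r| / (1 + r).
Proof.
move=> a0 c0 e0 r0 ->.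
have ra : 0 < r ^+ 2 * a + c by rewrite addr_gt0 ?mulr_gt0 ?exprn_gt0.
have ac : 0 < a + c by rewrite addr_gt0.
have r1 : 0 < 1 + r by rewrite addr_gt0.
have -> : a / (a + c) - r ^+ 2 * e2 * a / (r ^+ 2 * e2 * a + e2 * c) =
    (1 - r) / (1 + r) * (a * c * (1 + r) ^+ 2 / ((a + c) * (r ^+ 2 * a + c))).
  have n1 : r ^+ 2 * e2 * a + e2 * c != 0.
    by rewrite lt0r_neq0 ?addr_gt0 ?mulr_gt0 ?exprn_gt0.
  by field; rewrite (lt0r_neq0 ac) (lt0r_neq0 ra) (lt0r_neq0 r1) n1.
rewrite normrM normf_div (gtr0_norm r1).
rewrite ler_piMr ?divr_ge0 ?(ltW r1) //.
rewrite ger0_norm; last first.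
  by rewrite divr_ge0 ?mulr_ge0 ?exprn_ge0 ?(ltW r1) ?(ltW ac) ?(ltW ra) ?ltW.
rewrite ler_pdivrMr ?mulr_gt0 // mul1r.
have := sqr_ge0 (r * a - c); nra.
Qed.

(** The induction alternates between this and [field_bound]. Both range over all fields, since
    changing fields one at a time passes through intermediate ones. *)
Definition flip_bound S (F : V -> R) := forall h s u, u \notin S ->
  exists Q, is_coupling (law h S s) (law h S (upd s u (~~ s u))) Q /\
    cost Q (wdist S) <= \sum_(v in S | adj G u v) Gam [set u; v] * F v.

Definition field_bound S (F : V -> R) := forall h h' s z, z \in S ->
  (forall v, v != z -> h' v = h v) ->
  exists Q, is_coupling (law h S s) (law h' S s) Q /\
    cost Q (wdist S) <=
    tanh_gap (((h' z true - h z true) - (h' z false - h z false)) / 2) * F z.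

Lemma cost_coupling_le (p q : config V -> R) Q (D D' : config V -> config V -> R)
    (a : R) : is_coupling p q Q -> \sum_x p x = 1 ->
  (forall x y, D x y <= a + D' x y) -> cost Q D <= a + cost Q D'.
Proof.
move=> [Q0 Qp _] p1 DD.
have -> : a = \sum_x \sum_y Q x y * a.
  under eq_bigr do rewrite -mulr_suml Qp.
  by rewrite -mulr_suml p1 mul1r.
rewrite -big_split; apply: ler_sum => x _; rewrite -big_split.
by apply: ler_sum => y _ /=; rewrite -mulrDr ler_wpM2l.
Qed.

(** The spin at [z] is coupled optimally first. If the two copies agree there, the conditional laws
    coincide, as the fields differ only at [z]. If not, the cost is [w z] plus that of a flip of [z]
    seen from [S :\ z]. *)
Lemma field_bound_of_flip S (F : V -> R) (F' : V -> V -> R) :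
  (forall z, z \in S -> flip_bound (S :\ z) (F' z)) ->
  (forall z, z \in S ->
     F z = w z + \sum_(c in S :\ z | adj G z c) Gam [set z; c] * F' z c) ->
  (forall v, 0 <= F v) -> field_bound S F.
Proof.
move=> flipS FE F_ge0 h h' s z zS hh.
pose a c := part h (S :\ z) (upd s z c) / part h S s.
pose b c := part h' (S :\ z) (upd s z c) / part h' S s.
have wE c x : agree_outside (S :\ z) (upd s z c) x ->
    fweight G J beta h' x = expR (h' z c - h z c) * fweight G J beta h x.
  by rewrite agree_outside_upd // => /andP[_ /eqP <-]; apply: fweight_field.
have lawE c : law h' (S :\ z) (upd s z c) =1 law h (S :\ z) (upd s z c).
  apply: flaw_scale (wE c); by rewrite lt0r_neq0 ?expR_gt0.
have partE c := fpart_scale (wE c).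
have [||||P [cP Pd]] := @coupling_bool R a b.
- by move=> c; rewrite divr_ge0 // ltW ?fpart_gt0.
- by move=> c; rewrite divr_ge0 // ltW ?fpart_gt0.
- by rewrite -mulrDl -fpart_upd // divff // lt0r_neq0 ?fpart_gt0.
- by rewrite -mulrDl -fpart_upd // divff // lt0r_neq0 ?fpart_gt0.
have gapab : `|a true - b true| <=
    tanh_gap (((h' z true - h z true) - (h' z false - h z false)) / 2).
  rewrite /a /b (fpart_upd _ _ _ h s zS) (fpart_upd _ _ _ h' s zS) !partE.
  apply: odds_gap; rewrite ?fpart_gt0 ?expR_gt0 //.
  by rewrite expr2 -!expRD; congr expR; field.
have pair_coupling (cc : bool * bool) : exists Q, is_coupling (law h (S :\ z) (upd s z cc.1))
    (law h' (S :\ z) (upd s z cc.2)) Q /\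
    cost Q (wdist S) <= (cc.1 != cc.2)%:R * F z.
  case: cc => c c' /=; case: eqVneq => [<-|cc'].
    have [|||Q [cQ Q0]] := @coupling_eq _ _ (law h (S :\ z) (upd s z c))
      (law h' (S :\ z) (upd s z c)) (wdist S); last 1 first.
    - by exists Q; rewrite Q0 mul0r.
    - by move=> x; apply: flaw_ge0.
    - by move=> x; rewrite lawE.
    - exact: wdistxx.
  have [|Q [cQ Qc]] := flipS z zS h (upd s z c) z; first by rewrite !inE eqxx.
  have updE : upd (upd s z c) z (~~ upd s z c z) = upd s z c'.
    apply/ffunP => v; rewrite !ffunE eqxx; case: (v == z) => //.
    by move: (c) (c') cc' => [] [].
  move: cQ; rewrite updE => cQ; exists Q; split.
    case: cQ => Q0 Q1 Q2; split=> // y.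
    by rewrite Q2 lawE.
  rewrite mul1r FE //.
  apply: (le_trans (cost_coupling_le (a := w z) (D' := wdist (S :\ z)) cQ _ _)).
  - exact: sum_flaw.
  - move=> x y; rewrite /wdist (bigD1 z) //= lerD //.
      by rewrite ler_piMr // lern1; case: (_ != _).
    rewrite le_eqVlt; apply/orP; left; apply/eqP; apply: eq_bigl => v.
    by rewrite !inE andbC.
  - by rewrite lerD2l.
have [Q QP] := boolp.choice pair_coupling.
have [Q' [cQ' Q'E]] := @coupling_mixture _ _ _ a b
  (fun c => law h (S :\ z) (upd s z c)) (fun c => law h' (S :\ z) (upd s z c))
  P (fun i j => Q (i, j)) (wdist S) cP (fun i j => (QP (i, j)).1).
exists Q'; split.
  case: cQ' => Q0 Q1 Q2; split=> // x.
    by rewrite Q1 (flaw_split _ _ _ h s zS).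
  by rewrite Q2 (flaw_split _ _ _ h' s zS).
rewrite Q'E; apply: le_trans (_ : (P true false + P false true) * F z <= _).
  have P0 i j : 0 <= P i j by case: cP.
  rewrite !big_bool /=.
  have := ler_wpM2l (P0 true true) (QP (true, true)).2.
  have := ler_wpM2l (P0 false false) (QP (false, false)).2.
  have := ler_wpM2l (P0 true false) (QP (true, false)).2.
  have := ler_wpM2l (P0 false true) (QP (false, true)).2.
  rewrite /= !mul0r !mul1r !mulr0; lra.
by rewrite Pd ler_wpM2r.
Qed.

(** The flip of [u] is replaced by fields at its neighbours in [S], switched on one vertex at a
    time; the couplings are glued and their costs add up. *)
Lemma flip_bound_of_field S F : field_bound S F -> flip_bound S F.
Proof.
move=> fieldS h s u uS.
pose hh (r : seq V) v c := h v c + (v \in r)%:R * flip_field J beta s u v c.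
have interp (r : seq V) : uniq r -> {subset r <= S} ->
    exists Q, is_coupling (law h S s) (law (hh r) S s) Q /\
      cost Q (wdist S) <= \sum_(v <- r) Gam [set u; v] * F v.
  elim: r => [_ _|v r IH].
    have [|||Q [cQ Q0]] := @coupling_eq _ _ (law h S s)
      (law (hh [::]) S s) (wdist S); last 1 first.
    - by exists Q; rewrite Q0 big_nil.
    - by move=> x; apply: flaw_ge0.
    - apply: (flaw_scale (C := 1)); rewrite ?oner_neq0 // => x _; rewrite mul1r.
      rewrite /fweight; congr (expR (_ + _)); apply: eq_bigr => v _.
      by rewrite /hh mul0r addr0.
    - exact: wdistxx.
  rewrite cons_uniq => /andP[vr ur] sr.
  have [|Q1 [cQ1 Q1c]] := IH ur; first by move=> x xr; apply: sr; rewrite inE xr orbT.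
  have vS : v \in S by apply: sr; rewrite inE eqxx.
  have [|Q2 [cQ2 Q2c]] := fieldS (hh r) (hh (v :: r)) s v vS.
    by move=> x xv; rewrite /hh inE (negPf xv).
  have [Q [cQ Qc]] := coupling_trans (wdist_tri S) cQ1 cQ2.
  exists Q; split=> //; apply: (le_trans Qc); rewrite big_cons addrC.
  apply: lerD => //; apply: (le_trans Q2c).
  rewrite le_eqVlt; apply/orP; left; apply/eqP; congr (_ * _).
  (* The halved change of log-odds is [beta * J [set u; v]] up to a sign set by [s u], and
     [tanh_gap] is even. *)
  rewrite -[RHS]/(tanh_gap (beta * J [set u; v])) /hh inE eqxx (negPf vr) /flip_field.
  case: (s u) => /=; last by congr tanh_gap; field.
  by rewrite -[RHS]tanh_gapN; congr tanh_gap; field.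
pose r := enum [set v in S | adj G u v].
have [||Q1 [cQ1 Q1c]] := interp r; first exact: enum_uniq.
  by move=> v; rewrite mem_enum inE => /andP[].
have [C C0 flipE] := fweight_flip G J beta h s uS.
have hhE x : fweight G J beta (hh r) x =
    fweight G J beta (fun v c => h v c + ((v \in S) && adj G u v)%:R
                            * flip_field J beta s u v c) x.
  rewrite /fweight; congr (expR (_ + _)); apply: eq_bigr => v _.
  by rewrite /hh mem_enum inE.
set s' := upd s u (~~ s u).
have agreeE x : agree_outside S s x -> agree_outside S s' (upd x u (~~ s u)).
  move=> /agree_outsideP H; apply/agree_outsideP => v vS; rewrite !ffunE.
  by case: eqP => // _; apply: H.
have updK x : agree_outside S s x -> upd (upd x u (~~ s u)) u (s u) = x.
  move=> /agree_outsideP H; apply/ffunP => v; rewrite !ffunE.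
  by case: eqP => // ->; apply: H.
have updK' y : agree_outside S s' y -> upd (upd y u (s u)) u (~~ s u) = y.
  move=> /agree_outsideP H; apply/ffunP => v; rewrite !ffunE.
  by case: eqP => // ->; rewrite -H // ffunE eqxx.
have agreeE' y : agree_outside S s' y -> agree_outside S s (upd y u (s u)).
  move=> /agree_outsideP H; apply/agree_outsideP => v vS; rewrite !ffunE.
  by case: eqP => [->//|/eqP vu]; rewrite -H // ffunE (negPf vu).
have partE : part h S s' = C * part (hh r) S s.
  rewrite /fpart mulr_sumr.
  rewrite (reindex_onto (fun x => upd x u (~~ s u)) (fun y => upd y u (s u))); last first.
    by move=> y /updK'.
  rewrite (eq_bigl (agree_outside S s)) => [|x]; last first.
    apply/andP/idP => [[/agreeE' H /eqP e]|H]; first by rewrite -e.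
    by rewrite agreeE // updK.
  by apply: eq_bigr => x xs; rewrite flipE // hhE.
(* Flipping [u] multiplies all weights by the same [C], so it maps the law with the new fields onto
   the target law. As [u] is outside [S], this map costs nothing. *)
have [||Q2 [cQ2 Q2c]] := @coupling_map _ _ (law (hh r) S s) (law h S s')
   (fun x => upd x u (~~ s u)) (wdist S).
- by move=> x; apply: flaw_ge0.
- move=> y; rewrite {1}/flaw; case: ifP => ys; last first.
    rewrite big1 // => x /eqP xy; rewrite /flaw; case: ifP => // /agreeE.
    by rewrite xy ys.
  rewrite (bigD1 (upd y u (s u))) /=; last by rewrite updK'.
  rewrite big1 => [|x /andP[/eqP xy]]; last first.
    rewrite /flaw; case: ifP => // xs; rewrite -xy updK //.
    by rewrite eqxx.
  rewrite addr0 /flaw agreeE' // partE hhE -{1}(updK' y ys) flipE ?agreeE' //.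
  by field; rewrite C0 lt0r_neq0 ?fpart_gt0.
have [Q [cQ Qc]] := coupling_trans (wdist_tri S) cQ1 cQ2.
exists Q; split=> //; apply: (le_trans Qc).
rewrite Q2c big1 ?addr0.
  apply: (le_trans Q1c); rewrite big_enum_cond /=.
  by rewrite le_eqVlt; apply/orP; left; apply/eqP; apply: eq_bigl => v; rewrite inE andbT.
move=> x _; rewrite /wdist big1 ?mulr0 // => v vS; rewrite ffunE.
case: (eqVneq v u) => [vu|_]; last by rewrite eqxx mulr0.
by move: uS; rewrite -vu vS.
Qed.

Theorem flip_coupling k S : (#|S| <= k)%N ->
  flip_bound S (saw_sum G J beta w k S).
Proof.
have F_ge0 k' S' v : 0 <= saw_sum G J beta w k' S' v.
  by apply: sumr_ge0 => q _; rewrite mulr_ge0 ?walk_weight_ge0.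
elim: k S => [|k IH] S Sk; apply: flip_bound_of_field.
  by move=> h h' s z; move: Sk; rewrite leqn0 cards_eq0 => /eqP ->; rewrite inE.
apply: (field_bound_of_flip (F' := fun z => saw_sum G J beta w k (S :\ z))) => //.
  by move=> z zS; apply: IH; move: Sk; rewrite (cardsD1 z S) zS.
by move=> z zS; rewrite saw_sumS.
Qed.

End Disagreement.

(** * Counting self-avoiding walks in a tree with an extra edge *)

Section TreeCounting.
Variables (V : finType).

Lemma joinedC (F : {set {set V}}) x y : joined F x y = joined F y x.
Proof. by rewrite /joined finset.setUC. Qed.

(** Where the two paths first diverge, at [x], following [p] and then [q] backwards joins the two
    successors of [x] without meeting [x]. Shortened and closed up through [x], this is a cycle. *)
Lemma acyclic_path_inj (F : {set {set V}}) x p q :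
  (forall c, ~~ gcycle F c) ->
  path (joined F) x p -> uniq (x :: p) ->
  path (joined F) x q -> uniq (x :: q) -> last x p = last x q -> p = q.
Proof.
move=> acyc; elim: p x q => [|a p IH] x [|b q] //=.
- by move=> _ _ _ /andP[+ _] e; rewrite e mem_last.
- by move=> _ /andP[+ _] _ _ e; rewrite -e mem_last.
move=> /andP[xa pa] /andP[xap uap] /andP[xb qb] /andP[xbq ubq] e.
have [ab|ab] := eqVneq a b.
  by subst b; congr cons; apply: IH qb ubq e.
have walk : path (joined F) a (p ++ rev (belast b q)).
  rewrite cat_path pa e rev_path.
  by rewrite (eq_path (e' := joined F)) // => y z; rewrite joinedC.
have lastw : last a (p ++ rev (belast b q)) = b.
  rewrite last_cat e; case: (q) => //= c q'.
  by rewrite rev_cons last_rcons.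
have xw : x \notin a :: p ++ rev (belast b q).
  rewrite -cat_cons mem_cat (negPf xap) /= mem_rev.
  by apply: contra xbq => /mem_belast.
case: (shortenP walk) lastw => r pr ur sr lr.
have /negP[] := acyc (x :: a :: r); apply/and3P; split.
- by case: (r) lr => //= /eqP; rewrite (negPf ab).
- by rewrite /= xa rcons_path pr lr joinedC.
rewrite cons_uniq ur andbT; apply: contra xw; rewrite !inE.
by case/orP=> [-> //|/sr ->]; rewrite orbT.
Qed.

Lemma path_split_bad (T : Type) (e e' : rel T) x p :
  path e x p -> ~~ path e' x p -> exists p1 y p2,
    [/\ p = p1 ++ y :: p2, e (last x p1) y & ~~ e' (last x p1) y].
Proof.
elim: p x => //= y p IH x /andP[exy pp]; rewrite negb_and.
case: (boolP (e' x y)) => /= [_|exy' _]; last by exists [::], y, p.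
by case/(IH y pp) => p1 [t [p2 [-> ? ?]]]; exists (y :: p1), t, p2.
Qed.

Lemma sum_last_le (R : realType) (r : seq (seq V)) (P : pred (seq V)) v
    (B : {set V}) (f : V -> R) :
  (forall x, 0 <= f x) -> uniq r -> (forall q, q \in r -> last v q \in B) ->
  (forall q q', q \in r -> q' \in r -> P q -> P q' -> last v q = last v q' -> q = q') ->
  \sum_(q <- r | P q) f (last v q) <= \sum_(x in B) f x.
Proof.
move=> f0 ur rB inj; rewrite -big_filter -(big_map (last v) xpredT f).
rewrite big_uniq; last first.
  rewrite map_inj_in_uniq ?filter_uniq // => q q'.
  by rewrite !mem_filter => /andP[? ?] /andP[? ?]; apply: inj.
rewrite big_mkcond [leRHS]big_mkcond; apply: ler_sum => x _.
case: ifP => [/mapP[q]|]; last by case: ifP.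
by rewrite mem_filter => /andP[_ /rB qB ->]; rewrite qB.
Qed.

(** A self-avoiding walk stays in the tree [T], or crosses the extra edge once, in one of two
    directions. In each of these three classes the endpoint determines the walk, by uniqueness of
    paths in [T] before and after the crossing. *)
Lemma sum_saws_last_le (R : realType) (G : sgraph V) (B : {set V}) k v (f : V -> R) :
  tree_plus_edge G B -> v \in B -> (forall x, 0 <= f x) ->
  \sum_(q <- saws G k B v) f (last v q) <= 3 * \sum_(x in B) f x.
Proof.
move=> [T [TB [_ acyc] extra]] vB f0.
(* When there is no extra edge, the dummy pair [v, v] serves. *)
have [a [b abE]] : exists a b, forall g, g \in induced_edges G B :\: T -> g = [set a; b].
  case: (set_0Vmem (induced_edges G B :\: T)) => [->|[g gE]].
    by exists v, v => g; rewrite inE.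
  have /eqP/cards2P[a [b [_ gab]]] : #|g| = 2.
    by move: gE; rewrite !inE => /andP[_ /andP[/edges_card2]].
  exists a, b => g' g'E; rewrite -gab.
  by apply: (card_le1_eqP extra).
have stepT x y : x \in B -> y \in B -> adj G x y -> ~~ joined T x y ->
    (x = a /\ y = b) \/ (x = b /\ y = a).
  move=> xB yB xy nT; have e : [set x; y] = [set a; b].
    apply: abE; rewrite !inE -/(joined T x y) nT /=; apply/andP; split=> //.
    by apply/fintype.subsetP => t; rewrite !inE => /orP[]/eqP ->.
  have := set21 x y; have := set22 x y; rewrite e !inE.
  have /negPf xny := adj_neq xy.
  case/orP=> /eqP ye /orP[]/eqP xe; [|by right|by left|];
  by move: xny; rewrite xe ye eqxx.
have pathT x p c : c \in [:: a; b] -> path (adj G) x p -> {subset x :: p <= B} ->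
    c \notin x :: p -> path (joined T) x p.
  move=> cab; elim: p x => //= y p IH x /andP[xy pp] sB.
  rewrite !inE !negb_or => /and3P[cx cy cp].
  rewrite IH //; last by rewrite inE negb_or cy.
    rewrite andbT; apply: contraT => /(stepT x y _ _ xy); case.
    - by apply: sB; rewrite inE eqxx.
    - by apply: sB; rewrite !inE eqxx orbT.
    - by move=> [e1 e2]; move: cab cx cy; rewrite e1 e2 !inE => /orP[] ->.
    - by move=> [e1 e2]; move: cab cx cy; rewrite e1 e2 !inE => /orP[] ->.
  by move=> t tp; apply: sB; rewrite inE tp orbT.
pose P c c' q := `[< exists p1 p2, q = p1 ++ c' :: p2 /\ last v p1 = c >].
have cover q : q \in saws G k B v ->
    [|| path (joined T) v q, P a b q | P b a q].
  move=> /saw_mem[pq uq sq]; case: (boolP (path (joined T) v q)) => //= nT.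
  have [p1 [y [p2 [qE e1 e2]]]] := path_split_bad pq nT.
  have := stepT (last v p1) y _ _ e1 e2; case.
  - have := mem_last v p1; rewrite inE => /orP[/eqP -> //|lp].
    by apply: sq; rewrite qE mem_cat lp.
  - by apply: sq; rewrite qE mem_cat inE eqxx orbT.
  - by move=> [l1 yb]; apply/orP; left; apply/asboolP; exists p1, p2; rewrite -yb.
  - by move=> [l1 yb]; apply/orP; right; apply/asboolP; exists p1, p2; rewrite -yb.
have lastB q : q \in saws G k B v -> last v q \in B.
  move=> /saw_mem[_ _ sq]; have := mem_last v q.
  by rewrite inE => /orP[/eqP -> //|/sq].
have injP c c' : c \in [:: a; b] -> c' \in [:: a; b] -> forall q q',
    q \in saws G k B v -> q' \in saws G k B v ->
    P c c' q -> P c c' q' -> last v q = last v q' -> q = q'.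
  move=> cab c'ab q q' /saw_mem[pq uq sq] /saw_mem[pq' uq' sq'].
  move=> /asboolP[p1 [p2 [qE lp]]] /asboolP[p1' [p2' [qE' lp']]].
  have parts r r1 r2 : path (adj G) v r -> uniq (v :: r) -> {subset r <= B} ->
      r = r1 ++ c' :: r2 -> last v r1 = c ->
      [/\ path (joined T) v r1, uniq (v :: r1),
          path (joined T) c' r2 & uniq (c' :: r2)].
    move=> pr ur sr rE l1; move: ur; rewrite rE -cat_cons cat_uniq.
    move=> /and3P[ur1 /hasPn dis ur2].
    move: pr; rewrite rE cat_path /= => /and3P[pr1 _ pr2].
    split=> //.
      apply: (pathT v r1 c') => //; last by apply: dis; rewrite inE eqxx.
      by move=> t; rewrite inE => /orP[/eqP -> //|tr]; apply: sr; rewrite rE mem_cat tr.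
    apply: (pathT c' r2 c) => //.
      by move=> t tr; apply: sr; rewrite rE mem_cat tr orbT.
    by apply/negP => /dis; rewrite -l1 mem_last.
  have [t1 u1 t2 u2] := parts _ _ _ pq uq sq qE lp.
  have [t1' u1' t2' u2'] := parts _ _ _ pq' uq' sq' qE' lp'.
  rewrite qE qE' !last_cat /= => ll; congr (_ ++ _ :: _).
    by apply: acyclic_path_inj t1 u1 t1' u1' _ => //; rewrite lp.
  exact: acyclic_path_inj t2 u2 t2' u2' ll.
apply: (@le_trans _ _ (\sum_(q <- saws G k B v | path (joined T) v q) f (last v q)
  + \sum_(q <- saws G k B v | P a b q) f (last v q)
  + \sum_(q <- saws G k B v | P b a q) f (last v q))).
  rewrite [X in _ <= X + _ + _]big_mkcond [X in _ <= _ + X + _]big_mkcond.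
  rewrite [X in _ <= _ + X]big_mkcond -!big_split /= [leLHS]big_seq [leRHS]big_seq.
  apply: ler_sum => q /cover; have := f0 (last v q).
  by case: (path _ _ _); case: (P a b q); case: (P b a q) => //= ? _; lra.
have -> : 3 * \sum_(x in B) f x =
    \sum_(x in B) f x + \sum_(x in B) f x + \sum_(x in B) f x by ring.
rewrite !lerD // sum_last_le ?saws_uniq //.
- move=> q q' /saw_mem[_ uq _] /saw_mem[_ uq' _] pq pq'.
  exact: acyclic_path_inj pq uq pq' uq'.
- by apply: injP; rewrite !inE eqxx ?orbT.
- by apply: injP; rewrite !inE eqxx ?orbT.
Qed.

End TreeCounting.

(** * Products of influences and of aggregate influences along a walk *)

Section PathBounds.
Variables (R : realType) (V : finType) (G : sgraph V) (J : {set V} -> R).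
Variable beta : R.
Local Notation Gam := (Gamma J beta).
Local Notation Agg := (aggregate G J beta).

Lemma aggregate_ge0 v : 0 <= Agg v.
Proof. by apply: sumr_ge0 => c _; apply: Gamma_ge0. Qed.

(** At each vertex, stopping ([a x]) and moving on ([Gam [set x; c]]) share at most [Agg x]. Divided
    by [Agg x], these are probabilities of total at most 1, so the sum is at most the largest
    product of [Agg] along an admissible walk. [C] carries the product over the vertices already
    passed. *)
Lemma saw_sum_le_max (a : V -> R) (S0 : {set V}) (D : R) :
  (forall x, 0 <= a x) ->
  (forall x, x \in S0 ->
     a x + \sum_(c in S0 | adj G x c) Gam [set x; c] <= Agg x) ->
  0 <= D ->
  forall k (S : {set V}) v (P : pred (seq V)) (C : R),
  S \subset S0 -> v \in S0 -> 0 <= C ->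
  (forall q, q \in saws G k S v -> P q -> 0 < a (last v q) ->
     C * \prod_(x <- v :: q) Agg x <= D) ->
  C * \sum_(q <- saws G k S v | P q) walk_weight J beta v q * a (last v q) <= D.
Proof.
move=> a0 aA D0; elim=> [|k IH] S v P C SS vS C0 H.
  rewrite /= big_mkcond big_seq1 /= mul1r.
  case: ifP => [P0|_]; last by rewrite mulr0.
  have := a0 v; rewrite le_eqVlt => /orP[/eqP <-|av]; first by rewrite mulr0.
  have := H [::]; rewrite inE eqxx P0 /= big_seq1 => /(_ isT isT av).
  apply: le_trans; rewrite ler_wpM2l //; apply: le_trans (aA v vS).
  by rewrite lerDl sumr_ge0 // => c _; apply: Gamma_ge0.
rewrite big_sawsS /= mul1r.
set T := fun c => \sum_(q <- saws G k (S :\ v) c | P (c :: q))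
  walk_weight J beta c q * a (last c q).
under eq_bigr => c _.
  under eq_bigr => q _ do rewrite -mulrA.
  rewrite -mulr_sumr -/(T c); over.
have subS : S :\ v \subset S0.
  by apply: fintype.subset_trans SS; apply: subD1set.
have TD c : c \in S :\ v -> adj G v c -> C * Agg v * T c <= D.
  move=> cS vc; apply: IH => //.
  - by apply: (fintype.subsetP subS).
  - by rewrite mulr_ge0 ?aggregate_ge0.
  move=> q qs Pq aq; have := H (c :: q).
  rewrite [in X in X -> _]/= inE /= big_cons mulrA; apply=> //.
  apply/flatten_mapP; exists c; first by rewrite mem_enum inE cS.
  by apply/mapP; exists q.
have av : C * Agg v * (if P [::] then a v else 0) <= a v * D.
  case: ifP => [P0|_]; last by rewrite mulr0 mulr_ge0.
  have := a0 v; rewrite le_eqVlt => /orP[/eqP <-|av]; first by rewrite mulr0 mul0r.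
  have := H [::]; rewrite inE eqxx P0 /= big_seq1 => /(_ isT isT av) ?.
  by rewrite mulrC ler_wpM2l // ltW.
have sumG : \sum_(c in S :\ v | adj G v c) Gam [set v; c] <=
    \sum_(c in S0 | adj G v c) Gam [set v; c].
  rewrite big_mkcond [leRHS]big_mkcond; apply: ler_sum => c _.
  case: ifP => [/andP[/(fintype.subsetP subS) -> ->] //|_].
  by case: ifP => // _; apply: Gamma_ge0.
have aA' := le_trans (lerD (lexx (a v)) sumG) (aA v vS).
(* The averaging divides by [Agg v]; when that is zero, all shares at [v] vanish and so does the
   sum. *)
have := aggregate_ge0 v; rewrite le_eqVlt => /orP[/eqP A0|A_gt0].
  have sum0 : 0 <= \sum_(c in S :\ v | adj G v c) Gam [set v; c].
    by apply: sumr_ge0 => c _; apply: Gamma_ge0.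
  have av0 : a v = 0 by have := a0 v; lra.
  have : \sum_(c in S :\ v | adj G v c) Gam [set v; c] == 0.
    by rewrite eq_le sum0 andbT; have := a0 v; lra.
  rewrite psumr_eq0 => [/allP G0|c _]; last exact: Gamma_ge0.
  rewrite av0 if_same add0r big1 ?mulr0 // => c cS.
  by have /implyP/(_ cS)/eqP -> := G0 c (mem_index_enum c); rewrite mul0r.
rewrite -(ler_pM2l A_gt0) mulrA [Agg v * C]mulrC mulrDr.
apply: (@le_trans _ _ ((a v + \sum_(c in S :\ v | adj G v c) Gam [set v; c]) * D)).
  rewrite mulrDl lerD // mulr_suml mulr_sumr; apply: ler_sum => c /andP[cS vc].
  by rewrite mulrCA ler_wpM2l ?Gamma_ge0 ?TD.
by rewrite ler_wpM2r.
Qed.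

Lemma walk_weight_cat v q1 q2 : walk_weight J beta v (q1 ++ q2) =
  walk_weight J beta v q1 * walk_weight J beta (last v q1) q2.
Proof. by elim: q1 v => [|c q1 IH] v /=; rewrite ?mul1r // IH mulrA. Qed.

(* AM-GM at each interior vertex: two distinct neighbours share its aggregate
   influence. *)
Lemma walk_weight_interior x p y :
  path (adj G) x (rcons p y) -> uniq (x :: rcons p y) ->
  walk_weight J beta x (rcons p y) <= \prod_(v <- p) (Agg v / 2).
Proof.
move=> pp up.
(* In the square each edge can be charged once to each of its ends. The two extreme edges keep a
   spare factor at most 1; the first is kept in the invariant to feed the next AM-GM step. *)
suff sq : walk_weight J beta x (rcons p y) ^+ 2 <=
    Gam [set x; head y p] * \prod_(v <- p) (Agg v / 2) ^+ 2.
  have P0 : 0 <= \prod_(v <- p) (Agg v / 2).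
    by apply: prodr_ge0 => v _; rewrite divr_ge0 ?aggregate_ge0.
  rewrite -(@ler_pXn2r _ 2) ?nnegrE ?walk_weight_ge0 //.
  apply: (le_trans sq); rewrite prodrXl ler_piMl ?Gamma_le1 ?exprn_ge0 //.
elim: p x pp up => [|c p IH] x /=.
  move=> _ _; rewrite big_nil !mulr1 expr2 ler_piMl ?Gamma_ge0 ?Gamma_le1 //.
move=> /andP[xc pp] /andP[xcp ucp].
have hin : head y p \in rcons p y by case: (p) => [|? ?]; rewrite inE eqxx.
have ch : adj G c (head y p) by case: (p) pp => [|? ?] /= /andP[].
have xh : x != head y p.
  by apply: contraNneq xcp => ->; rewrite inE hin orbT.
have Ac : Gam [set x; c] + Gam [set c; head y p] <= Agg c.
  rewrite /aggregate (bigD1 x) /=; last by rewrite adjC.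
  rewrite (bigD1 (head y p)) /=; last by rewrite ch eq_sym.
  rewrite finset.setUC addrA lerDl sumr_ge0 // => t _; exact: Gamma_ge0.
have g1 := Gamma_ge0 J beta [set x; c].
have g2 := Gamma_ge0 J beta [set c; head y p].
rewrite exprMn big_cons.
apply: (@le_trans _ _ (Gam [set x; c] ^+ 2 *
   (Gam [set c; head y p] * \prod_(v <- p) (Agg v / 2) ^+ 2))).
  by rewrite ler_wpM2l ?exprn_ge0 ?IH.
have P0 : 0 <= \prod_(v <- p) (Agg v / 2) ^+ 2.
  by apply: prodr_ge0 => v _; rewrite exprn_ge0 // divr_ge0 ?aggregate_ge0.
have sq : (Gam [set x; c] + Gam [set c; head y p]) ^+ 2 <= Agg c ^+ 2.
  by rewrite lerXn2r ?nnegrE ?addr_ge0 ?aggregate_ge0.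
move: (Gam [set x; c]) (Gam [set c; head y p]) (\prod_(v <- p) _) g1 P0 sq {g2 Ac}.
move=> g h P g0 P0 sq; rewrite expr2 -mulrA ler_wpM2l // mulrA ler_wpM2r //.
have := sqr_ge0 (g - h); nra.
Qed.

End PathBounds.

(** * Consequences of the block vertex condition for short and long walks *)

Section BlockVertices.
Variables (R : realType) (V : finType) (G : sgraph V) (J : {set V} -> R).
Variables (beta d eps : R).
Hypotheses (eps_gt0 : 0 < eps) (eps_lt1 : eps < 1) (d_ge4 : 4 <= d).
Local Notation Agg := (aggregate G J beta).
Local Notation M := (Mweight G J beta d eps).
Local Notation logn := (ln (#|V|%:R : R)).

Lemma Mweight_ge v : 3 <= 4 * M v.
Proof.
move: (eps_gt0) (eps_lt1) (d_ge4) => e0 e1 d4.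
rewrite /Mweight; case: (leP (Agg v) (1 - eps / 2)) => A; first by lra.
have := ler_wpM2r (aggregate_ge0 G J beta v) d_ge4; lra.
Qed.

Lemma aggregate_le_Mweight v : Agg v <= M v.
Proof.
move: (eps_gt0) (eps_lt1) (d_ge4) => e0 e1 d4.
rewrite /Mweight; case: (leP (Agg v) (1 - eps / 2)) => A; first by lra.
have := ler_wpM2r (aggregate_ge0 G J beta v) d_ge4; lra.
Qed.

Lemma prod_aggregate_ge0 p : 0 <= \prod_(v <- p) Agg v.
Proof. by apply: prodr_ge0 => v _; apply: aggregate_ge0. Qed.

Lemma prod_aggregate_le p : \prod_(v <- p) Agg v <= \prod_(v <- p) M v.
Proof.
by apply: ler_prod => v _; rewrite aggregate_ge0 aggregate_le_Mweight.
Qed.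

(** Either every factor is at most [1 - eps / 2], or some vertex has [M v = d * Agg v] and
    contributes the factor [d], the others satisfying [Agg v <= M v]. *)
Lemma prod_aggregate_dichotomy p : p != [::] ->
  \prod_(v <- p) Agg v <= 1 - eps / 2 \/
  d * \prod_(v <- p) Agg v <= \prod_(v <- p) M v.
Proof.
move: (eps_gt0) (eps_lt1) (d_ge4) => e0 e1 d4.
elim: p => // x p IH _; rewrite !big_cons.
have Ax := aggregate_ge0 G J beta x.
have pA := prod_aggregate_ge0 p; have pM := prod_aggregate_le p.
have := aggregate_le_Mweight x.
case: (leP (Agg x) (1 - eps / 2)) => A xM; last first.
  have Mx : M x = d * Agg x by rewrite /Mweight leNgt A.
  by right; rewrite Mx mulrA ler_wpM2l // mulr_ge0 //; lra.
have [p0|/IH[H|H]] := eqVneq p [::].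
- by left; rewrite p0 big_nil mulr1.
- left; nra.
- right; rewrite mulrCA; apply: (@le_trans _ _ (Agg x * \prod_(v <- p) M v)).
    by rewrite ler_wpM2l.
  by rewrite ler_wpM2r ?aggregate_le_Mweight // (le_trans pA).
Qed.

(** Dropping the start [u] from the product costs a factor at most [4 / 3], as [M u] is at least
    [3 / 4]. *)
Lemma block_vertex_prodM u p : block_vertex G J beta d eps u ->
  gpath G u p -> (size p)%:R <= logn -> 3 * \prod_(v <- p) M v <= 4.
Proof.
move: (eps_gt0) (eps_lt1) (d_ge4) => e0 e1 d4.
move=> bu gp /(bu p gp); rewrite big_cons => H.
have := Mweight_ge u; have : 0 <= \prod_(v <- p) M v.
  by apply: prodr_ge0 => v _; have := Mweight_ge v; lra.
nra.
Qed.

Lemma block_vertex_prod u p : block_vertex G J beta d eps u ->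
  gpath G u p -> (size p)%:R <= logn -> p != [::] ->
  \prod_(v <- p) Agg v <= 1 - eps / 2.
Proof.
move: (eps_gt0) (eps_lt1) (d_ge4) => e0 e1 d4.
move=> bu gp sp /prod_aggregate_dichotomy[//|H].
have := block_vertex_prodM bu gp sp; have := prod_aggregate_ge0 p; nra.
Qed.

Lemma gpath_take u p k : gpath G u p -> gpath G u (take k p).
Proof.
move=> /andP[pp up]; apply/andP; split; first exact: take_path.
move: up; rewrite /= => /andP[up /(take_uniq k) ->].
by rewrite andbT; apply: contra up => /mem_take.
Qed.

Lemma gpath_rev x p w : path (adj G) x (rcons p w) -> uniq (rcons p w) ->
  gpath G w (rev p).
Proof.
move=> pp up; apply/andP; split.
  have := rev_path (adj G) x (rcons p w); rewrite last_rcons belast_rcons.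
  rewrite rev_cons rcons_path => e; move: pp.
  rewrite -(eq_path (e := fun z => adj G ^~ z)); last by move=> ? ?; rewrite adjC.
  by rewrite -e => /andP[].
by rewrite /= mem_rev rev_uniq -rcons_uniq.
Qed.

(** The at most [2 * L] vertices are cut after the first [L]: the front part is a path from [u], the
    reversed rest a path from [w], both of length at most [logn]. *)
Lemma short_path_prod u v q w (L : nat) : (0 < L)%N -> L%:R <= logn ->
  block_vertex G J beta d eps u -> gpath G u (v :: q) ->
  block_vertex G J beta d eps w -> adj G (last v q) w -> w \notin v :: q ->
  (size q < 2 * L)%N -> \prod_(x <- v :: q) Agg x <= 1 - eps / 2.
Proof.
move: (eps_gt0) (eps_lt1) (d_ge4) => e0 e1 d4.
move=> L0 Ln bu gu bw lw wq sq.
have szle (n : nat) : (n <= L)%N -> n%:R <= logn.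
  by move=> nL; apply: le_trans Ln; rewrite ler_nat.
have [sL|sL] := ltnP (size q) L; first by apply: (block_vertex_prod bu); rewrite ?szle.
rewrite -(cat_take_drop L (v :: q)) big_cat /=.
have p1 : \prod_(x <- take L (v :: q)) Agg x <= 1 - eps / 2.
  apply: (block_vertex_prod bu); first exact: gpath_take.
    by rewrite szle // size_take /=; case: ltnP; lia.
  by rewrite -size_eq0 size_take /=; case: ltnP; lia.
have p2 : \prod_(x <- drop L (v :: q)) Agg x <= 1 - eps / 2.
  rewrite (perm_big (rev (drop L (v :: q)))) /=; last by rewrite perm_sym perm_rev.
  have dE : exists x, path (adj G) x (drop L (v :: q)) /\
      last x (drop L (v :: q)) = last v q.
    have : path (adj G) u (v :: q) by case/andP: gu.
    rewrite -{1}(cat_take_drop L (v :: q)) cat_path => /andP[_ ?].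
    exists (last u (take L (v :: q))); split=> //.
    by rewrite -last_cat cat_take_drop.
  have [x [px lx]] := dE.
  apply: (block_vertex_prod bw).
  - apply: (@gpath_rev x); first by rewrite rcons_path px lx.
    rewrite rcons_uniq drop_uniq; last by case/andP: gu => _ /=/andP[].
    by rewrite andbT; apply: contra wq => /mem_drop.
  - by rewrite szle // size_rev size_drop /=; move: sq sL; clear; lia.
  - by rewrite -size_eq0 size_rev size_drop /=; move: sq sL; clear; lia.
have := prod_aggregate_ge0 (take L (v :: q)).
have := prod_aggregate_ge0 (drop L (v :: q)); nra.
Qed.

Lemma prod_half p : \prod_(v <- p) (Agg v / 2) = \prod_(v <- p) Agg v / 2 ^+ size p.
Proof.
elim: p => [|x p IH]; rewrite ?big_nil ?big_cons /= ?divr1 // IH exprS.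
by field; rewrite expf_neq0.
Qed.

(** The walk, prolonged to [w], is cut into its first [L] edges, a middle of weight at most 1, and a
    tail with [L] interior vertices. AM-GM gives [1 / 2] per interior vertex of the two ends, whose
    aggregate products are controlled from [u] and from [w]. *)
Lemma long_path_weight u v q w (L : nat) : (0 < L)%N -> L%:R <= logn ->
  block_vertex G J beta d eps u -> gpath G u (v :: q) ->
  block_vertex G J beta d eps w -> adj G (last v q) w -> w \notin v :: q ->
  (2 * L <= size q)%N ->
  walk_weight J beta v q * Gamma J beta [set last v q; w] <= 8 / 4 ^+ L.
Proof.
move: (eps_gt0) (eps_lt1) (d_ge4) => e0 e1 d4.
move=> L0 Ln bu gu bw lw wq sq.
have /andP[/= /andP[uv pq] /andP[uvq uq]] := gu.
rewrite -/(uniq (v :: q)) in uq.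
have szle (n : nat) : (n <= L)%N -> n%:R <= logn.
  by move=> nL; apply: le_trans Ln; rewrite ler_nat.
pose m := (size q - L)%N.
have Lm : (L <= m)%N by rewrite /m; move: sq; clear; lia.
have qE : q = take L q ++ (drop L (take m q) ++ drop m q).
  rewrite catA -[X in X ++ _](_ : take m q = _) ?cat_take_drop //.
  by rewrite -[LHS](cat_take_drop L) take_takel.
set q1 := take L q in qE; set q2 := drop L _ in qE; set q3 := drop m q in qE.
have s1 : size q1 = L by rewrite size_takel //; move: sq; clear; lia.
have s3 : size q3 = L by rewrite size_drop /m; move: sq; clear; lia.
have pqw : path (adj G) v (rcons q w) by rewrite rcons_path pq.
have uqw : uniq (v :: rcons q w).
  by rewrite -rcons_cons rcons_uniq wq.
have -> : walk_weight J beta v q * Gamma J beta [set last v q; w] =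
    walk_weight J beta v q1 * (walk_weight J beta (last v q1) q2 *
     walk_weight J beta (last v (q1 ++ q2)) (rcons q3 w)).
  rewrite last_cat -!walk_weight_cat -rcons_cat -rcons_cat -qE -cats1.
  by rewrite walk_weight_cat /= mulr1.
(* This piece has only [L - 1] interior vertices, hence one factor 2. The other bounds their
   aggregate product: with [M v >= 3 / 4] also removed, it is at most [16 / 9]. *)
have b1 : walk_weight J beta v q1 <= 2 * 2 / 2 ^+ L.
  case/lastP: q1 s1 qE => [|p y]; first by move=> /= e; move: L0; rewrite -e.
  rewrite size_rcons => s1 qE.
  apply: (le_trans (walk_weight_interior (G := G) (x := v) _ _ _ _)).
  - by move: pq; rewrite qE cat_path => /andP[].
  - by move: uq; rewrite qE -cat_cons cat_uniq => /andP[].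
  rewrite prod_half -s1 exprS invfM mulrA [2 * 2 / 2]mulfK //.
  rewrite ler_wpM2r ?invr_ge0 ?exprn_ge0 //.
  apply: le_trans (prod_aggregate_le p) _.
  have := @block_vertex_prodM u (v :: p) bu; rewrite big_cons.
  have := Mweight_ge v; have : 0 <= \prod_(v <- p) M v.
    by apply: prodr_ge0 => x _; have := Mweight_ge x; lra.
  move=> P0 Mv H; suff: 3 * (M v * \prod_(v <- p) M v) <= 4 by nra.
  apply: H; last by rewrite szle //= s1.
  have -> : v :: p = take L (v :: q) by rewrite qE -cats1 -catA -s1 /= take_size_cat.
  exact: gpath_take.
have b3 : walk_weight J beta (last v (q1 ++ q2)) (rcons q3 w) <= 2 / 2 ^+ L.
  have p3 : path (adj G) (last v (q1 ++ q2)) (rcons q3 w).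
    by move: pqw; rewrite qE catA rcons_cat cat_path => /andP[].
  have u3 : uniq (last v (q1 ++ q2) :: rcons q3 w).
    move: uqw; rewrite qE catA rcons_cat -cat_cons lastI cat_rcons.
    by rewrite cat_uniq => /and3P[].
  apply: (le_trans (walk_weight_interior _ _ p3 u3)).
  rewrite prod_half s3 ler_wpM2r ?invr_ge0 ?exprn_ge0 //.
  apply: le_trans (prod_aggregate_le _) _.
  rewrite (perm_big (rev q3)) /=; last by rewrite perm_sym perm_rev.
  have gr : gpath G w (rev q3) by apply: gpath_rev p3 _; case/andP: u3.
  have := block_vertex_prodM bw gr; rewrite size_rev s3 => /(_ Ln); lra.
have -> : 8 / 4 ^+ L = (2 * 2 / 2 ^+ L) * (1 * (2 / 2 ^+ L)) :> R.
  have -> : (4 : R) = 2 * 2 by ring.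
  by rewrite exprMn; field; rewrite expf_neq0.
by rewrite !ler_pM ?mulr_ge0 ?walk_weight_ge0 ?walk_weight_le1.
Qed.

End BlockVertices.

(** * Numerical estimates for large [n] *)

Section Estimates.
Variable R : realType.

(** From [1 - 1 / 4 <= expR (- (1 / 4))] one gets [expR 1 <= (4 / 3) ^+ 4 = 256 / 81]. *)
Lemma expR1_le : 5 * expR (1 : R) <= 16.
Proof.
have := expR_ge1Dx (- (1 / 4) : R).
rewrite expRN; set e := expR (1 / 4); have e0 : 0 < e by apply: expR_gt0.
have -> : expR 1 = e ^+ 4 by rewrite -expRM_natl; congr expR; field.
move=> H; have {H} e4 : 3 * e <= 4.
  have := ler_wpM2r (ltW e0) H; rewrite mulVf ?lt0r_neq0 //; lra.
have e2 : 9 * e ^+ 2 <= 16 by nra.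
have -> : e ^+ 4 = e ^+ 2 * e ^+ 2 by ring.
have := sqr_ge0 e; nra.
Qed.

Lemma ln2_ge : 1 <= 2 * ln (2 : R).
Proof.
have := expR_ge1Dx (- (1 / 2) : R); rewrite expRN => H.
have e0 := expR_gt0 (1 / 2 : R).
have {H} e2 : expR (1 / 2 : R) <= 2.
  have := ler_wpM2r (ltW e0) H; rewrite mulVf ?lt0r_neq0 //; lra.
have : ln (expR (1 / 2 : R)) <= ln 2 by rewrite ler_ln ?posrE.
rewrite expRK; lra.
Qed.

(** A form of Bernoulli's inequality for [(5 / 4) ^+ L]. *)
Lemma natr_le_pow L : L%:R * 4 ^+ L <= 4 * 5 ^+ L :> R.
Proof.
elim: L => [|L IH]; first by rewrite mul0r.
rewrite -natr1 !exprS.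
have : (4 : R) ^+ L <= 5 ^+ L by rewrite lerXn2r ?nnegrE // ler_nat.
have : (0 : R) <= 4 ^+ L by rewrite exprn_ge0.
by move: IH; move: (L%:R) (4 ^+ L) (5 ^+ L) => l a b; nra.
Qed.

Lemma large_size_bounds (n : nat) (eps : R) : 0 < eps -> eps < 1 ->
  2000 / eps <= ln (n%:R : R) -> exists L : nat,
  [/\ (0 < L)%N, L%:R <= ln (n%:R : R), 24 * n%:R / 4 ^+ L <= eps / 6
    & 3 * n%:R <= eps / 6 * n%:R ^+ 4].
Proof.
move=> e0 e1 nbig; set l := ln _ in nbig *.
have leps : 2000 <= eps * l.
  by move: nbig; rewrite ler_pdivrMr // mulrC.
have l_ge : 2000 <= l by nra.
have n0 : 0 < (n%:R : R).
  by rewrite lt0r ler0n andbT; apply/eqP => n0; move: l_ge; rewrite /l n0 ln0 //; lra.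
have nE : n%:R = expR l by rewrite lnK ?posrE.
have nl : l <= n%:R by rewrite nE; have := expR_ge1Dx l; lra.
have /andP[Ll lL] := trunc_itv (le_trans (ler0n R 2000) l_ge).
move: (Num.trunc l) Ll lL => L Ll; rewrite -natr1 => lL.
exists L; split=> //.
- by rewrite -(ltr0n R); lra.
- have L0 : 0 < L%:R :> R by lra.
  have a0 : 0 < (4 : R) ^+ L by rewrite exprn_gt0.
  have b0 : 0 < (5 : R) ^+ L by rewrite exprn_gt0.
  (* Since [ln n < L + 1], [n] is at most [(16 / 5) ^+ L.+1]. *)
  have nup : n%:R * (5 * 5 ^+ L) <= 16 * (4 * 4) ^+ L :> R.
    apply: (@le_trans _ _ ((5 * expR 1) ^+ L.+1)); last first.
      have -> : (16 : R) * (4 * 4) ^+ L = 16 ^+ L.+1.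
        by rewrite exprS; congr (_ * _ ^+ _); ring.
      by rewrite lerXn2r ?nnegrE ?mulr_ge0 ?expR_ge0 ?expR1_le.
    rewrite exprMn mulrC -exprS ler_wpM2l ?exprn_ge0 //.
    by rewrite nE -expRM_natl ler_expR -natr1; lra.
  rewrite ler_pdivrMr //.
  have pw := natr_le_pow L; rewrite exprMn in nup.
  (* Now [24 * n / 4 ^+ L] is at most [24 * (16 / 5) * (4 / 5) ^+ L], hence at most [307.2 / L].
     This is below [eps / 6] once [eps * L] reaches 1844, whence the constant 2000. *)
  have Leps : 1900 <= eps * L%:R by nra.
  rewrite -(ler_pM2r (_ : 0 < 5 * 5 ^+ L)); last by rewrite mulr_gt0.
  apply: (@le_trans _ _ (24 * (16 * (4 ^+ L * 4 ^+ L)))).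
    by rewrite -mulrA ler_wpM2l.
  move: pw; move: (4 ^+ L) (5 ^+ L) a0 b0 => a b a0 b0 pw.
  have : eps * (L%:R * a) <= eps * (4 * b) by rewrite ler_wpM2l // ltW.
  move=> H; have H2 : 1900 * a <= 4 * (eps * b).
    apply: le_trans (_ : eps * (L%:R * a) <= _); last by lra.
    by rewrite mulrA ler_wpM2r // ltW.
  have := ler_wpM2r (ltW a0) H2; nra.
have n1 : 18 <= eps * n%:R by nra.
have n2 : 1 <= n%:R :> R by lra.
have n3 : 1 <= n%:R ^+ 2 :> R by rewrite exprn_ege1.
have -> : eps / 6 * n%:R ^+ 4 = (eps * n%:R) * n%:R ^+ 2 * n%:R / 6 by field.
have : 18 * 1 <= eps * n%:R * n%:R ^+ 2 by rewrite ler_pM.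
move=> H; have := ler_wpM2r (ltW n0) H; lra.
Qed.

End Estimates.

(** * The weighted walk sum over one block *)

Section Blocks.
Variables (R : realType) (V : finType) (G : sgraph V) (J : {set V} -> R).
Variables (beta d eps : R) (BB : {set {set V}}).
Hypotheses (eps_gt0 : 0 < eps) (eps_lt1 : eps < 1) (d_ge4 : 4 <= d).
Hypothesis BBP : block_partition G J beta d eps BB.
Local Notation Gam := (Gamma J beta).
Local Notation Agg := (aggregate G J beta).
Local Notation Ao := (Aout G J beta BB).
Local Notation N := (#|V|%:R : R).

Definition dist_weight v : R :=
  if v \in Wset G J beta BB then N ^+ 4 * Ao v else 1.

Lemma Aout_ge0 v : 0 <= Ao v.
Proof. by apply: sumr_ge0 => c _; apply: Gamma_ge0. Qed.

Lemma dist_weight_ge0 v : 0 <= dist_weight v.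
Proof.
by rewrite /dist_weight; case: ifP => // _; rewrite mulr_ge0 ?exprn_ge0 ?Aout_ge0.
Qed.

Lemma dist_weight_le v : dist_weight v <= N ^+ 4 * Ao v + 1.
Proof.
have := Aout_ge0 v; rewrite /dist_weight; case: ifP => _ a0; first by rewrite lerDl.
by rewrite lerDr mulr_ge0 ?exprn_ge0.
Qed.

Lemma config_distE s t : config_dist G J beta BB s t = wdist dist_weight [set: V] s t.
Proof.
rewrite /config_dist /wdist [RHS](bigID (mem (Wset G J beta BB))) /= addrC.
congr (_ + _).
  apply: eq_big => v; first by rewrite !inE.
  by rewrite in_setC => /negPf vW; rewrite /dist_weight vW mul1r.
rewrite mulr_sumr; apply: eq_big => v; first by rewrite in_setT.
by move=> vW; rewrite /dist_weight vW mulrA.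
Qed.

Lemma config_dist_agree B s t x y : agree_outside B s x -> agree_outside B t y ->
  config_dist G J beta BB x y <= config_dist G J beta BB s t + wdist dist_weight B x y.
Proof.
move=> /agree_outsideP sx /agree_outsideP ty; rewrite !config_distE /wdist.
rewrite (bigID (mem B)) /= addrC; apply: lerD; last first.
  by rewrite le_eqVlt; apply/orP; left; apply/eqP; apply: eq_bigl => v; rewrite inE.
rewrite [leRHS](bigID (mem B)) /= [leRHS]addrC.
rewrite (eq_bigr (fun v => dist_weight v * (s v != t v)%:R)); last first.
  by move=> v /andP[_ vB]; rewrite sx // ty.
by rewrite lerDl sumr_ge0 // => v _; rewrite mulr_ge0 ?dist_weight_ge0.
Qed.

(** Pairs charged by [Q] agree with [s] and [t] outside [B], because the marginals vanish elsewhere;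
    only disagreements inside [B] can add to the distance. *)
Lemma coupling_config_dist B s t Q :
  is_coupling (flaw G J beta (fun _ _ => 0) B s) (flaw G J beta (fun _ _ => 0) B t) Q ->
  cost Q (config_dist G J beta BB) <=
  config_dist G J beta BB s t + cost Q (wdist dist_weight B).
Proof.
move=> cQ; have [Q0 Q1 Q2] := cQ.
have -> : config_dist G J beta BB s t = \sum_x \sum_y Q x y * config_dist G J beta BB s t.
  under eq_bigr do rewrite -mulr_suml Q1.
  by rewrite -mulr_suml sum_flaw mul1r.
rewrite -big_split; apply: ler_sum => x _; rewrite -big_split /=.
apply: ler_sum => y _; rewrite -mulrDr.
have [sx|nsx] := boolP (agree_outside B s x); last first.
  have : \sum_y Q x y == 0 by rewrite Q1 /flaw (negPf nsx).
  rewrite psumr_eq0 // => /allP/(_ y (mem_index_enum y)) /eqP ->.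
  by rewrite !mul0r.
have [ty|nty] := boolP (agree_outside B t y); last first.
  have : \sum_x Q x y == 0 by rewrite Q2 /flaw (negPf nty).
  rewrite psumr_eq0 // => /allP/(_ x (mem_index_enum x)) /eqP ->.
  by rewrite !mul0r.
by rewrite ler_wpM2l // config_dist_agree.
Qed.

Variables (B : {set V}) (u z : V).
Hypotheses (BBB : B \in BB) (uB : u \in bd_out G B) (zB : z \in B) (uz : adj G u z).

Lemma pblock_block x : x \in B -> finset.pblock BB x = B.
Proof. by have [/and3P[_ triv _] _] := BBP; apply: def_pblock. Qed.

Lemma Aout_add_aggregate x : x \in B ->
  Ao x + \sum_(c in B | adj G x c) Gam [set x; c] = Agg x.
Proof.
move=> xB; rewrite /Aout pblock_block // addrC [RHS](bigID (mem B)) /=.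
by congr (_ + _); apply: eq_bigl => c; rewrite andbC.
Qed.

Lemma Aout_gt0_nbr x : x \in B -> 0 < Ao x -> exists2 c, adj G x c & c \notin B.
Proof.
move=> xB; rewrite /Aout pblock_block // => A0.
have [c /andP[xc cB]|none] := pickP (fun c => adj G x c && (c \notin B)).
  by exists c.
by move: A0; rewrite big_pred0 // ltxx.
Qed.

Lemma bd_out_notin : u \notin B. Proof. by move: uB; rewrite inE => /andP[]. Qed.

Lemma mem_bd_out x c : x \in B -> adj G x c -> c \notin B -> c \in bd_out G B.
Proof.
by move=> xB xc cB; rewrite inE cB; apply/exists_inP; exists x => //; rewrite adjC.
Qed.

Lemma saw_sum_large_block : (2 <= #|B|)%N -> 2000 / eps <= ln N ->
  saw_sum G J beta dist_weight #|B| B z <= N ^+ 4 * (1 - eps / 6).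
Proof.
move: (eps_gt0) (eps_lt1) (d_ge4) => e0 e1 d4.
move=> B2 /large_size_bounds[] // L [L0 Ln nL n4].
have [_ /(_ B BBB)[tree /(_ B2)[bdB _] _]] := BBP.
have [bu _] := bdB u uB.
have gu q : q \in saws G #|B| B z -> gpath G u (z :: q).
  move=> /saw_mem[pq uq sq]; rewrite /gpath /= uz pq /=.
  move: uq => /= ->; rewrite andbT inE negb_or (adj_neq uz) /=.
  by apply/negP => /sq; apply/negP/bd_out_notin.
have lastB q : q \in saws G #|B| B z -> last z q \in B.
  move=> /saw_mem[_ _ sq]; have := mem_last z q.
  by rewrite inE => /orP[/eqP -> //|/sq].
have notin q c : q \in saws G #|B| B z -> c \notin B -> c \notin z :: q.
  move=> /saw_mem[_ _ sq] cB; apply: contra cB; rewrite inE.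
  by move=> /orP[/eqP -> //|/sq].
have short : \sum_(q <- saws G #|B| B z | (size q < 2 * L)%N)
    walk_weight J beta z q * Ao (last z q) <= 1 - eps / 2.
  rewrite -[leLHS]mul1r; apply: (saw_sum_le_max (S0 := B)) => //.
  - exact: Aout_ge0.
  - by move=> x /Aout_add_aggregate ->.
  - lra.
  move=> q qs sq Aq; rewrite mul1r.
  have [c qc cB] := Aout_gt0_nbr (lastB q qs) Aq.
  apply: (short_path_prod e0 e1 d4 L0 Ln bu (gu q qs) _ qc (notin q c qs cB) sq).
  by have [] := bdB c (mem_bd_out (lastB q qs) qc cB).
pose f x : R := #|[set c | adj G x c && (c \notin B)]|%:R.
(* Double counting: each outer boundary vertex has exactly one neighbour in [B], so it is counted
   once. *)
have fsum : \sum_(x in B) f x <= N.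
  rewrite /f -natr_sum ler_nat.
  under eq_bigr do rewrite -sum1_card big_mkcond.
  rewrite exchange_big /= -[leqRHS]sum1_card; apply: leq_sum => c _.
  rewrite -big_mkcondr /=.
  have [cbd|ncbd] := boolP (c \in bd_out G B).
    have [_ card1] := bdB c cbd; rewrite -[leqRHS]card1 -[leqRHS]sum1_card.
    rewrite [leqRHS](eq_bigl (fun x => (x \in B) && adj G c x)); last first.
      by move=> x; rewrite !inE.
    rewrite big_mkcond [leqRHS]big_mkcond; apply: leq_sum => x _.
    by rewrite !inE adjC; case: (x \in B); case: (adj G c x); case: (c \in B).
  rewrite big_pred0 // => x; apply: contraNF ncbd => /andP[xB].
  by rewrite inE => /andP[xc cB]; apply: mem_bd_out xB xc cB.
(* Each long walk is prolonged by one edge to every outer neighbour of its endpoint; that neighbour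
   is the second block vertex. *)
have long : \sum_(q <- saws G #|B| B z | ~~ (size q < 2 * L)%N)
    walk_weight J beta z q * Ao (last z q) <= 24 * N / 4 ^+ L.
  apply: (@le_trans _ _ (\sum_(q <- saws G #|B| B z) 8 / 4 ^+ L * f (last z q))).
    rewrite big_mkcond [leLHS]big_seq [leRHS]big_seq; apply: ler_sum => q qs.
    case: ifP => [|_]; last by rewrite mulr_ge0 ?divr_ge0 ?exprn_ge0.
    rewrite -leqNgt => sq; rewrite /Aout pblock_block ?lastB // mulr_sumr.
    rewrite /f -sum1_card natr_sum mulr_sumr.
    rewrite [leRHS](eq_bigl (fun c => adj G (last z q) c && (c \notin B))); last first.
      by move=> c; rewrite !inE.
    apply: ler_sum => c /andP[qc cB]; rewrite mulr1.
    apply: (long_path_weight e0 e1 d4 L0 Ln bu (gu q qs) _ qc (notin q c qs cB) sq).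
    by have [] := bdB c (mem_bd_out (lastB q qs) qc cB).
  rewrite -mulr_sumr.
  have := sum_saws_last_le #|B| (f := f) tree zB (fun x => ler0n _ _) => H.
  have -> : 24 * N / 4 ^+ L = 8 / 4 ^+ L * (3 * N) by field; rewrite expf_neq0.
  rewrite ler_wpM2l ?divr_ge0 ?exprn_ge0 //; apply: (le_trans H).
  by rewrite ler_wpM2l.
have count : \sum_(q <- saws G #|B| B z) walk_weight J beta z q <= 3 * N.
  apply: (@le_trans _ _ (\sum_(q <- saws G #|B| B z) 1)).
    by apply: ler_sum => q _; apply: walk_weight_le1.
  apply: (le_trans (sum_saws_last_le #|B| (f := fun=> 1) tree zB _)) => //.
  rewrite ler_wpM2l //= sumr_const ler_nat; exact: max_card.
apply: (@le_trans _ _ (\sum_(q <- saws G #|B| B z)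
   (N ^+ 4 * (walk_weight J beta z q * Ao (last z q)) + walk_weight J beta z q))).
  apply: ler_sum => q _.
  have := ler_wpM2l (walk_weight_ge0 J beta z q) (dist_weight_le (last z q)).
  by rewrite mulrDr mulr1 mulrCA.
rewrite big_split -mulr_sumr /=.
rewrite [X in _ * X](bigID (fun q => size q < 2 * L)%N) /=.
have N0 : 0 <= N ^+ 4 by rewrite exprn_ge0.
(* The three contributions add up: [1 - eps / 2] from short walks, [eps / 6] from long ones, and
   [eps / 6] from the unit weights outside [W]. *)
have := ler_wpM2l N0 (lerD short (le_trans long nL)); lra.
Qed.

(** Only the trivial walk remains. Positivity of the influence puts [z] in [W], so its weight is
    exactly [N ^+ 4 * Ao z], and the path of length 0 gives [M z < 1], which forces
    [Agg z <= 1 - eps / 2]. *)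
Lemma saw_sum_singleton : B = [set z] -> 0 < Gam [set z; u] ->
  saw_sum G J beta dist_weight #|B| B z <= N ^+ 4 * (1 - eps / 6).
Proof.
move: (eps_gt0) (eps_lt1) (d_ge4) => e0 e1 d4.
move=> Bz Guz; have [_ /(_ B BBB)[_ _ /(_ z Bz) bz]] := BBP.
have zW : z \in Wset G J beta BB.
  rewrite inE /Aout pblock_block // (bigD1 u) /=; last by rewrite adjC uz bd_out_notin.
  by rewrite ltr_pwDl // sumr_ge0 // => c _; apply: Gamma_ge0.
rewrite {1}Bz cards1 saw_sumS big_pred0 => [|c]; last first.
  by rewrite Bz !inE; case: eqP.
rewrite addr0 /dist_weight zW ler_wpM2l ?exprn_ge0 //.
have AoA : Ao z <= Agg z.
  by rewrite -Aout_add_aggregate // lerDl sumr_ge0 // => c _; apply: Gamma_ge0.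
have lnN : 0 <= ln N.
  by rewrite ln_ge0 // ler1n; apply/card_gt0P; exists z.
have := bz [::]; rewrite /gpath /= big_seq1 => /(_ isT lnN).
rewrite /Mweight; case: (leP (Agg z) (1 - eps / 2)) => A H; first by lra.
have := ler_wpM2r (aggregate_ge0 G J beta z) d4; lra.
Qed.

End Blocks.

(** * Lower bounds on the size of the graph and on the influences *)

Section Largeness.
Variables (R : realType) (V : finType) (G : sgraph V) (J : {set V} -> R).

Lemma tree_plus_edge_nbr (B : {set V}) z : tree_plus_edge G B -> z \in B ->
  (2 <= #|B|)%N -> exists2 c, adj G z c & c \in B.
Proof.
move=> [T [TB [conn _] _]] zB B2.
have [y yB yz] : exists2 y, y \in B & y != z.
  have /card_gt0P[y] : (0 < #|B :\ z|)%N by move: B2; rewrite (cardsD1 z) zB.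
  by rewrite !inE => /andP[? ?]; exists y.
have /connectP[[|c p] /=] := conn z y zB yB; first by move=> _ e; rewrite e eqxx in yz.
move=> /andP[zc _] _; exists c.
  by have := fintype.subsetP TB _ zc; rewrite inE => /andP[].
have := fintype.subsetP TB _ zc; rewrite inE => /andP[_ /fintype.subsetP]; apply.
by rewrite !inE eqxx orbT.
Qed.

(** The [Upsilon] bound at the one-vertex path [v] gives [ln 2 <= ln n / ln d ^+ 2]. *)
Lemma calG_ln_card (d eps beta : R) v : calG d eps G J beta -> 1 <= ln d ->
  (2 <= deg G v)%N -> ln d <= 2 * ln (#|V|%:R : R).
Proof.
move=> [/andP[beta0 _] _ ups _] ld dv.
have lnN : 0 <= ln (#|V|%:R : R).
  by rewrite ln_ge0 // ler1n; apply/card_gt0P; exists v.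
have ld2 : 0 < ln d ^+ 2 by rewrite exprn_gt0 //; lra.
have := ups v [::]; rewrite /gpath /= => /(_ isT).
rewrite divr_ge0 ?exprn_ge0 //; last by lra.
move=> /(_ isT); rewrite ler_pdivlMr // /Upsilon big_seq1 => H.
have ln2 : ln 2 <= ln ((deg G v)%:R : R).
  by rewrite ler_ln ?posrE ?ler_nat // ltr0n; lia.
have s0 : 0 <= beta * \sum_(f in edges G | [exists v0 in f, v0 \in [:: v]]) `|J f|.
  by rewrite mulr_ge0 ?(ltW beta0) ?sumr_ge0.
have := ln2_ge R; move: (\sum_(f in edges G | _) _) s0 H => S s0 H l2.
have : (1 / 2) * ln d ^+ 2 <= ln (#|V|%:R : R).
  apply: le_trans H; rewrite ler_wpM2r ?(ltW ld2) //; lra.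
nra.
Qed.

Lemma calG_Gamma_gt0 (d eps beta : R) f : calG d eps G J beta -> f \in edges G ->
  0 < Gamma J beta f.
Proof.
move=> [/andP[beta0 _] _ _ /(_ f)] H fE; have /andP[Jf _] := H fE.
have J0 : J f != 0.
  rewrite -normr_gt0; apply: lt_le_trans Jf; rewrite powR_gt0 // ltr0n.
  have /card_gt0P[x xf] : (0 < #|f|)%N by rewrite (edges_card2 fE).
  by apply/card_gt0P; exists x.
rewrite divr_gt0 ?addr_gt0 ?expR_gt0 // normr_gt0 subr_eq0 eq_sym.
rewrite -[X in _ == X]expR0 (inj_eq (@expR_inj R)).
by rewrite mulf_neq0 // lt0r_neq0.
Qed.

End Largeness.

(** * Combining the flip coupling with the block estimate *)

Theorem theorem7p1 (R : realType) (eps : R) (eps_gt0 : 0 < eps) :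
  exists d0 : R, forall d : R, d0 <= d ->
  forall (V : finType) (G : sgraph V) (J : {set V} -> R) (beta : R),
    0 < beta <= (1 - eps) * beta_c d ->
    calG d eps G J beta ->
  forall BB : {set {set V}}, block_partition G J beta d eps BB ->
  forall (sigma tau : config V) (ustar : V),
    (forall v : V, sigma v <> tau v <-> v = ustar) ->
    ustar \in Wset G J beta BB ->
  forall (B : {set V}) (z : V),
    B \in BB -> ustar \in bd_out G B -> z \in B -> adj G ustar z ->
  exists Q : config V -> config V -> R,
    is_coupling (block_update G J beta B sigma) (block_update G J beta B tau) Q
    /\ (\sum_(x : config V) \sum_(y : config V)
          Q x y * config_dist G J beta BB x y)
       - config_dist G J beta BB sigma tau
       <= Gamma J beta [set ustar; z] * #|V|%:R ^+ 4 * (1 - eps / 6).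
Proof.
(* The value 4 serves the comparison of [Mweight] with [aggregate]; [4000 / eps] is twice the lower
   bound on [ln n] required for large blocks, as [ln d <= 2 * ln n]. *)
exists (Num.max 4 (expR (4000 / eps))) => d; rewrite ge_max => /andP[d4 dexp].
move=> V G J beta /andP[beta0 betac] GJ BB BBP s t u st _ B z BBB uB zB uz.
(* Otherwise no positive [beta] is at most [(1 - eps) * beta_c d]. *)
have eps_lt1 : eps < 1.
  rewrite ltNge; apply/negP => e1; have : (1 - eps) * beta_c d <= 0.
    rewrite mulr_le0_ge0 ?subr_le0 // divr_ge0 ?sqrtr_ge0 //; lra.
  by move=> /(le_trans betac); rewrite leNgt beta0.
have uN : u \notin B := bd_out_notin uB.
have tE : t = upd s u (~~ s u).
  apply/ffunP => v; rewrite ffunE; case: eqP => [->|vu].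
    have /st : u = u by []; by case: (s u) (t u) => [] [].
  by case: (eqVneq (t v) (s v)) => // /eqP ts; case: vu; apply/st => e; apply: ts.
have [tree bd _] := BBP.2 B BBB.
have unbr v : v \in B -> adj G u v -> v = z.
  move=> vB uv; have [B1|B2] := leqP #|B| 1.
    by apply: (card_le1_eqP B1).
  have [/(_ u uB)[_ /eqP/cards1P[x xE]] _] := bd B2.
  have : v \in [set x in B | adj G u x] by rewrite inE vB.
  have : z \in [set x in B | adj G u x] by rewrite inE zB.
  by rewrite xE !inE => /eqP -> /eqP ->.
have F_le : saw_sum G J beta (dist_weight G J beta BB) #|B| B z <=
    #|V|%:R ^+ 4 * (1 - eps / 6).
  have [B1|B2] := leqP #|B| 1.
    apply: (saw_sum_singleton eps_gt0 eps_lt1 d4 BBP BBB uB zB uz).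
      apply/setP => v; rewrite inE; apply/idP/eqP => [vB|->//].
      exact: (card_le1_eqP B1).
    by apply: (calG_Gamma_gt0 GJ); rewrite finset.setUC.
  apply: (saw_sum_large_block eps_gt0 eps_lt1 d4 BBP BBB uB zB uz B2).
  have [c zc cB] := tree_plus_edge_nbr tree zB B2.
  have ld : 4000 / eps <= ln d.
    by rewrite -[leLHS]expRK ler_ln ?posrE ?expR_gt0 //; lra.
  have ld1 : 1 <= ln d.
    by apply: le_trans ld; rewrite ler_pdivlMr //; lra.
  have deg2 : (2 <= deg G z)%N.
    apply: (@leq_trans #|[set u; c]|).
      rewrite cards2; suff -> : u != c by [].
      by apply: contraNneq uN => ->.
    apply: fintype.subset_leq_card; apply/fintype.subsetP => x.
    by rewrite !inE => /orP[]/eqP -> //; rewrite adjC.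
  have := calG_ln_card GJ ld1 deg2; move: ld.
  have -> : 4000 / eps = 2 * (2000 / eps) by field; rewrite lt0r_neq0.
  lra.
have [Q [cQ Qc]] := flip_coupling G J beta (@dist_weight_ge0 R V G J beta BB)
  (leqnn #|B|) (fun _ _ => 0) s uN.
rewrite -tE in cQ; exists Q; split.
  case: cQ => Q0 Q1 Q2; split=> // x; by rewrite block_update_flaw.
rewrite lerBlDl; apply: (le_trans (coupling_config_dist BB cQ)).
rewrite lerD2l; apply: (le_trans Qc).
(* The disagreement at [u] enters [B] only through its unique neighbour [z]. *)
rewrite (big_pred1 z) => [|v]; last first.
  by apply/andP/eqP => [[]|->//]; apply: unbr.
by rewrite -mulrA ler_wpM2l ?Gamma_ge0.
Qed.
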